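(* Fix $j\in\mathbb N$ and write $\phi=\phi_j$, $\lambda=\lambda_j$. Let $0<x\le 1$ and suppose $\phi'(x)$ exists. Then $$x\phi'(x)+\phi(x)-\lambda\phi(1)K(x,1)=P(x),$$ where $P(x)=-\lambda\int_0^1K(x,y)Q(y)\,dy$ and $Q(y)=y\phi'(y)$ at those $y$ where $\phi'(y)$ exists.
   Context: Let $K:[0,1]\times[0,1]\to\mathbb R$ be defined by $K(x,y)=\frac12-\{(xy)^{-1}\}$ if $0<x,y\le 1$, and $K(x,y)=0$ if $0\le x,y\le1$ and $xy=0$, where $\{\alpha\}=\alpha-\lfloor\alpha\rfloor$. Let $L^2([0,1])$ denote the space of real-valued Lebesgue measurable square-integrable functions on $[0,1]$, with $\langle f,g\rangle=\int_0^1 f(x)g(x)\,dx$ and $\|f\|=\langle f,f\rangle^{1/2}$. A function $\phi$ is an eigenfunction of $K$ (with eigenvalue $\lambda\in\mathbb R$) if $\phi\in L^2([0,1])$, $\|\phi\|>0$, and $\phi(x)=\lambda\int_0^1 K(x,y)\phi(y)\,dy$ for every $x\in[0,1]$. Let $\phi_1,\phi_2,\ldots$ be a maximal orthonormal system in $L^2([0,1])$ of eigenfunctions of $K$, $\phi_j$ having the nonzero real eigenvalue $\lambda_j$, numbered so that $0<|\lambda_1|\le|\lambda_2|\le\cdots$ and $\lambda_j\ge\lambda_{j+1}$ whenever $|\lambda_j|=|\lambda_{j+1}|$. (The derivative $\phi'$ exists at all points of $(0,1]$ outside a countable set, and $y\mapsto y\phi'(y)$ is measurable and square integrable on $[0,1]$,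 so $P(x)$ is well defined for each $x\in[0,1]$.) *)

(* Defs.v *)
From HB Require Import structures.
From mathcomp Require Import all_boot all_order all_algebra.
From mathcomp Require Import all_classical all_reals all_analysis.
Set Implicit Arguments. Unset Strict Implicit. Unset Printing Implicit Defensive.
Import Order.TTheory GRing.Theory Num.Theory.
Import numFieldNormedType.Exports.
Local Open Scope classical_set_scope.
Local Open Scope ring_scope.

(* The carrier of the completed Lebesgue measure on R (Lebesgue measurable sets). *)
Definition LR (R : realType) :=
  caratheodory_type (R:=R)
    (T:=lebesgue_stieltjes_measure_ocitv_type__canonical__measurable_structure_SemiRingOfSets R)
    (wlength idfun)^*%mu.

Definition leb (R : realType) : set (LR R) -> \bar R := @completed_lebesgue_measure R.

Definition I01 (R : realType) : set (LR R) := `[(0 : R), 1].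

Definition int01 (R : realType) (f : R -> R) : R :=
  Rintegral (@leb R) (@I01 R) (f : LR R -> R).

Definition frac (R : realType) (a : R) : R := a - (Num.floor a)%:~R.

Definition K (R : realType) (x y : R) : R :=
  if (0 < x) && (0 < y) then 2^-1 - frac (x * y)^-1 else 0.

Definition is_eigenfunction (R : realType) (phi : R -> R) (lam : R) : Prop :=
  [/\ measurable_fun (@I01 R) (phi : LR R -> R),
      (\int[@leb R]_(y in (@I01 R)) ((phi y) ^+ 2)%:E < +oo)%E,
      (0 < \int[@leb R]_(y in (@I01 R)) ((phi y) ^+ 2)%:E)%E &
      forall x : R, 0 <= x <= 1 -> phi x = lam * int01 (fun y => K x y * phi y)].

(* d is the derivative of phi at x, where phi is regarded as a function on
   [0,1] (so the difference quotient is taken only with x + h in [0,1];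
   at x = 1 this is the left derivative, in the interior the usual one). *)
Definition has_deriv01 (R : realType) (phi : R -> R) (x d : R) : Prop :=
  (fun h : R => (phi (x + h) - phi x) / h)
    @ within [set h : R | h != 0 /\ 0 <= x + h <= 1] (nbhs (0 : R)) --> d.

Definition deriv01_exists (R : realType) (phi : R -> R) (x : R) : Prop :=
  exists d, has_deriv01 phi x d.

(* phi'(x): the derivative where it exists (0 by convention elsewhere). *)
Definition deriv01 (R : realType) (phi : R -> R) (x : R) : R :=
  xget 0 [set d | has_deriv01 phi x d].

(* Q(y) = y phi'(y) where phi'(y) exists (0 elsewhere: a countable, hence
   null, set which does not affect the integral defining P). *)
Definition Qf (R : realType) (phi : R -> R) (y : R) : R :=
  if `[< deriv01_exists phi y >] then y * deriv01 phi y else 0.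

Definition Pf (R : realType) (phi : R -> R) (lam x : R) : R :=
  - lam * int01 (fun y => K x y * Qf phi y).

(* Main.v *)
From HB Require Import structures.
From mathcomp Require Import all_boot all_order all_algebra.
From mathcomp Require Import all_classical all_reals all_analysis.
From mathcomp Require Import measurable_realfun ring lra.
Require Import Defs.
Set Implicit Arguments. Unset Strict Implicit. Unset Printing Implicit Defensive.
Import Order.TTheory GRing.Theory Num.Theory.
Import numFieldNormedType.Exports.
Local Open Scope classical_set_scope.
Local Open Scope ring_scope.

(** Write [f] for [phi] restricted to (0,1], and [k u = 1/2 - {1/u}].  The
    dilation [y = v/t] turns the eigenvalue equation at [t x] into
    [t f(t x) - f(x) = lam * \int k(x v) (f(v/t) - f(v)) dv], where [f] is
    extended by 0.  Dividing by [1 - t] and letting [t] tend to 1 from below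
    gives the identity; the mass of the right-hand side on (t,1] produces the
    boundary term [lam * phi 1 * K x 1].

    Dominated convergence needs [f] to be differentiable almost everywhere with
    increments controlled by an integrable function.  This is obtained in steps:
    - [f] is bounded, and [|f x - f x'| <= C sqrt |1/x - 1/x'|], because
      [floor (1/(x y))] is monotone in [x] and its integral scales;
    - on each interval [1/((n+1)x) < y <= 1/(n x)] the function
      [k (x y) / y^2] has mean zero while [f] oscillates by at most
      [C sqrt x], hence [|f x| <= D sqrt x];
    - thanks to this decay, expanding the floor gives
      [f x = lam (Phi 1 / 2 - Psi / x + \sum_n Phi (1/(n x)))] with
      [Phi t = \int_0^t f] and [Psi = \int_0^1 f(y)/y dy], and hence
      [f b - f a = \int_a^b S] with
      [S z = lam / z^2 * (Psi - \sum_n f (1/(n z)) / n)];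
    - the last bracket is the error of a quadrature rule for [Psi]; the two
      bounds on the oscillation of [f] interpolate to [(x y)^(1/4)] and give
      [|S z| <= A z^(1/4) / z^2], so that [z S z] is integrable. *)

(** * Borel functions and the completed Lebesgue measure *)

Section measurability.
Context {R : realType}.

(** Inversion is continuous on either side of 0, and the point 0 is a measurable set of its own. *)
Lemma measurable_inv : measurable_fun [set: R] (@GRing.inv R).
Proof.
rewrite -set_itvNyy (@itv_bndbnd_setU _ _ _ (BLeft 0))//.
apply/measurable_funU => //; split.
- apply: open_continuous_measurable_fun; first exact: interval_open.
  move=> x; rewrite inE/= in_itv/= => x0; apply: inv_continuous.
  by rewrite lt_eqF.
- rewrite (@itv_bndbnd_setU _ _ _ (BRight 0)) ?bnd_simp//.
  apply/measurable_funU => //; split.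
    by rewrite set_itv1; exact: measurable_fun_set1.
  apply: open_continuous_measurable_fun; first exact: interval_open.
  move=> x; rewrite inE/= in_itv/= andbT => x0; apply: inv_continuous.
  by rewrite gt_eqF.
Qed.

Lemma measurable_floor : measurable_fun [set: R] (fun a : R => (Num.floor a)%:~R : R).
Proof.
apply: nondecreasing_measurable => // a b ab.
by rewrite ler_int le_floor.
Qed.

Lemma borel_lebesgue (A : set R) : measurable (A : set (measurableTypeR R)) ->
  measurable (A : set (LR R)).
Proof. exact: sub_caratheodory. Qed.

Lemma measurable_id_LR : measurable_fun [set: LR R] (idfun : LR R -> measurableTypeR R).
Proof. by move=> _ A mA; rewrite setTI; exact: borel_lebesgue. Qed.

(** The identity, from the completed to the Borel structure, is measurable and carries the completed
    measure to [lebesgue_measure]. Nonnegative functions are thus covered by the push-forward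
    formula, and the rest by positive and negative parts. *)
Lemma integral_leb (D : set R) (g : R -> \bar R) :
  measurable (D : set (measurableTypeR R)) ->
  measurable_fun (D : set (measurableTypeR R)) g ->
  (\int[@leb R]_(x in D) g x = \int[lebesgue_measure]_(x in D) g x)%E.
Proof.
move=> mD mg; rewrite [LHS]integralE [RHS]integralE.
have H (h : R -> \bar R) : measurable_fun (D : set (measurableTypeR R)) h ->
    (forall x, (0 <= h x)%E) ->
    (\int[@leb R]_(x in D) h x = \int[lebesgue_measure]_(x in D) h x)%E.
  move=> mh h0.
  have := @ge0_integral_pushforward _ _ _ _ R _ measurable_id_LR (@completed_lebesgue_measure R) D h mD mh (fun x _ => h0 x).
  rewrite [in X in _ = X -> _]/= => <-.
  apply: eq_measure_integral; [exact: measurable_id_LR|done].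
by rewrite !H//; [exact: measurable_funeneg|exact: measurable_funepos].
Qed.

End measurability.

(** * Behaviour of integrals under dilations of the line *)

Section scaling.
Context {R : realType}.
Notation mu := (@lebesgue_measure R).
Implicit Types (g : R -> R) (t : R).

Let measurable_scale t : measurable_fun [set: measurableTypeR R]
  ((fun v => v / t) : measurableTypeR R -> measurableTypeR R).
Proof. by apply: measurable_funM. Qed.

Let nnginv t (t0 : 0 < t) : 0 <= t^-1. Proof. by rewrite invr_ge0 ltW. Qed.

Lemma ge0_integral_scale t (g : R -> \bar R) : 0 < t ->
  measurable_fun [set: R] g -> (forall x, (0 <= g x)%E) ->
  (\int[mu]_v g (v / t)%R = t%:E * \int[mu]_v g v)%E.
Proof.
move=> t0 mg g0.
pose ti : {nonneg R} := NngNum (nnginv t0).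
pose psi := ((fun v => v / t) : measurableTypeR R -> measurableTypeR R).
have mpsi : measurable_fun setT psi by exact: measurable_scale.
pose pm := measure_function_pushforward__canonical__measure_function_Measure mu mpsi.
(* By uniqueness of Lebesgue measure, checked on half-open intervals, [mu] is [t^-1] times its image
   under [v / t]. *)
have E (A : set (measurableTypeR R)) : measurable A ->
    mu A = mscale ti pm A.
  apply: lebesgue_measure_unique => _ [[a b] _ <-].
  transitivity ((t^-1)%:E * mu [set` `]a * t, b * t]%R])%E; last first.
    congr (_ * mu _)%E; apply/seteqP; split => x /=; rewrite !in_itv/= /psi.
      by rewrite ltr_pdivlMr// ler_pdivrMr.
    by rewrite ltr_pdivlMr// ler_pdivrMr.
  rewrite !lebesgue_measure_itv/= !lte_fin ltr_pM2r//.
  case: ifPn => _; last by rewrite mule0.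
  by rewrite -!EFinB -EFinM -mulrBl mulrCA mulVf ?mulr1// gt_eqF.
have := @ge0_integral_pushforward _ _ _ _ R _ mpsi mu setT g measurableT mg (fun x _ => g0 x).
rewrite preimage_setT => <-.
rewrite (eq_measure_integral (mscale ti pm) (fun A mA _ => E A mA)).
rewrite ge0_integral_mscale// muleA -EFinM/= divff ?gt_eqF// mul1e.
by [].
Qed.

Lemma integrable_scale t g : 0 < t -> mu.-integrable setT (EFin \o g) ->
  mu.-integrable setT (EFin \o (fun v => g (v / t))).
Proof.
move=> t0 /integrableP[/measurable_EFinP mg gy]; apply/integrableP; split.
  apply/measurable_EFinP; apply: measurableT_comp => //.
  exact: measurable_scale.
rewrite (@ge0_integral_scale t (fun x => `|(g x)%:E|%E))//.
  by rewrite lte_mul_pinfty// ?lee_fin ?ltW.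
by apply/measurableT_comp => //; exact/measurable_EFinP.
Qed.

Lemma Rintegral_scale t g : 0 < t -> mu.-integrable setT (EFin \o g) ->
  (\int[mu]_v g (v / t) = t * \int[mu]_v g v)%R.
Proof.
move=> t0 ig; have ig' := integrable_scale t0 ig.
have fg := integrable_fin_num measurableT ig.
rewrite /Rintegral -[t in RHS]/(fine t%:E) -fineM//; congr fine.
have mg := measurable_int _ ig.
rewrite integralE [in RHS]integralE.
rewrite muleBr//; last first.
  by apply: fin_num_adde_defl; rewrite fin_numN; apply: integrable_neg_fin_num.
rewrite -!ge0_integral_scale//.
- by congr (_ - _)%E; apply: eq_integral => x _; rewrite ?funeposE ?funenegE.
- exact: measurable_funeneg.
- exact: measurable_funepos.
Qed.

End scaling.

(** * Integrals over half-open intervals, and of powers *)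

Section interval_integrals.
Context {R : realType}.
Notation mu := (@lebesgue_measure R).
Implicit Types (f g : R -> R) (a b c M p : R).

Lemma Rintegral_itv_split f a b c : a <= b -> b <= c ->
  mu.-integrable `]a, c] (EFin \o f) ->
  \int[mu]_(y in `]a, c]) f y =
  \int[mu]_(y in `]a, b]) f y + \int[mu]_(y in `]b, c]) f y.
Proof.
move=> ab bc fi; rewrite -(Rintegral_itvB (x := b) fi) ?bnd_simp//.
by rewrite addrC subrK.
Qed.

Lemma itv_oc_finite a b : (mu `]a, b] < +oo)%E.
Proof. by rewrite lebesgue_measure_itv/=; case: ifP => _; rewrite ?ltry. Qed.

Lemma integrable_itv_bounded f a b M : measurable_fun setT f ->
  (forall y, a < y <= b -> `|f y| <= M) -> mu.-integrable `]a, b] (EFin \o f).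
Proof.
move=> mf fM; apply: measurable_bounded_integrable => //.
- exact: itv_oc_finite.
- exact: measurable_funTS.
- exists M; split; first exact: num_real.
  move=> x Mx y /=; rewrite in_itv/= => yab.
  by rewrite (le_trans (fM _ yab))// ltW.
Qed.

Lemma Rintegral_itv_cst a b M : a <= b -> \int[mu]_(y in `]a, b]) M = M * (b - a).
Proof.
move=> ab; rewrite Rintegral_cst//= lebesgue_measure_itv/= lte_fin.
case: ltP => //= ba; have -> : b = a by apply/le_anti; rewrite ab ba.
by rewrite subrr.
Qed.

Lemma integrable_itv_cst a b M : mu.-integrable `]a, b] (EFin \o (fun _ : R => M)).
Proof. by apply: (@integrable_itv_bounded _ _ _ `|M|) => // ? _. Qed.

Lemma Rintegral_itv_bound f a b M : a <= b -> measurable_fun setT f ->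
  (forall y, a < y <= b -> `|f y| <= M) ->
  `|\int[mu]_(y in `]a, b]) f y| <= M * (b - a).
Proof.
move=> ab mf fM; have fi := integrable_itv_bounded mf fM.
apply: (le_trans (le_normr_Rintegral _ fi)) => //.
rewrite -Rintegral_itv_cst//; apply: le_Rintegral => //.
- exact: integrable_norm.
- exact: integrable_itv_cst.
Qed.

Lemma powR_within_continuous p a b : 0 < a ->
  {within `[a, b], continuous (fun y : R => y `^ p)}.
Proof.
move=> a0; apply: continuous_in_subspaceT => x; rewrite inE/= in_itv/= => /andP[ax xb].
apply: differentiable_continuous; apply/derivable1_diffP.
by apply: derivable_powR; rewrite in_itv/= andbT (lt_le_trans a0).
Qed.

(** The exponent has the form [p - 1] so that [y^p / p] is the antiderivative; hence the later
    exponents [-1 - 1], [-2 - 1] and [4^-1 - 1]. *)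
Lemma Rintegral_powR p a b : p != 0 -> 0 < a -> a <= b ->
  \int[mu]_(y in `]a, b]) (y `^ (p - 1)) = (b `^ p - a `^ p) / p.
Proof.
move=> p0 a0; rewrite le_eqVlt => /predU1P[<-|ab].
  by rewrite set_itvoc0 Rintegral_set0 subrr mul0r.
have mp : measurable_fun setT (fun y : R => y `^ (p - 1)) by exact: measurable_powR.
rewrite /Rintegral integral_itv_obnd_cbnd; last first.
  by apply/measurable_EFinP; exact: measurable_funTS.
pose F (y : R) := y `^ p / p.
have dF (y : R) : 0 < y -> is_derive y 1 F (y `^ (p - 1)).
  move=> y0.
  have := is_derive1_powR p y0.
  move=> H; have := is_deriveM H (is_derive_cst (p^-1 : R) y 1).
  rewrite !scaler0 add0r => HH; apply: is_derive_eq.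
  by rewrite /GRing.scale/= mulrA mulVf// mul1r.
rewrite (@continuous_FTC2 _ (fun y => y `^ (p - 1)) F)//.
- by rewrite /F -EFinB/= mulrBl.
- exact: powR_within_continuous.
- have cF y : 0 < y -> {for y, continuous F}.
    move=> y0; apply: differentiable_continuous; apply/derivable1_diffP.
    by have [] := dF _ y0.
  split.
  + move=> y; rewrite in_itv/= => /andP[ay _].
    by have [] := dF _ (lt_trans a0 ay).
  + exact/cvg_at_right_filter/cF.
  + by apply/cvg_at_left_filter/cF; exact: lt_trans ab.
- move=> y; rewrite in_itv/= => /andP[ay _].
  by rewrite derive1E; have [_] := dF _ (lt_trans a0 ay).
Qed.

Lemma integrable_powR p a b : 0 < a ->
   mu.-integrable `]a, b] (EFin \o (fun y => y `^ p)).
Proof.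
move=> a0; apply: (@integrableS _ _ _ mu `[a, b]) => //.
  exact: subset_itv_oc_cc.
apply: continuous_compact_integrable; first exact: segment_compact.
exact: powR_within_continuous.
Qed.

(** Monotone convergence along the intervals []1/(n+1), 1]], on which the explicit value is at most
    [1/p]. *)
Lemma integral_powR01 p : 0 < p ->
  (\int[mu]_(y in `]0%R, 1%R]) (y `^ (p - 1))%:E <= (p^-1)%:E)%E.
Proof.
move=> p0.
pose F (n : nat) : set R := [set` `]n.+1%:R^-1, 1]].
have FE : \bigcup_n F n = [set` `]0, 1]].
  apply/seteqP; split => [x [n _]|x]; rewrite /F/= !in_itv/=.
    by move=> /andP[nx ->]; rewrite andbT (lt_trans _ nx).
  move=> /andP[x0 x1]; exists (Num.truncn x^-1) => //=; rewrite in_itv/= x1 andbT.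
  rewrite -[ltRHS]invrK ltf_pV2 ?posrE ?invr_gt0//.
  exact: truncnS_gt.
have := @ge0_nondecreasing_set_cvg_integral _ (measurableTypeR R) R F (fun y => (y `^ (p - 1))%:E) mu.
rewrite FE => H.
have {}H : (\int[mu]_(x in F i) (x `^ (p - 1))%:E @[i --> \oo] -->
   \int[mu]_(x in `]0%R, 1%R]) (x `^ (p - 1))%:E)%E.
  apply: H.
  - move=> n m nm; rewrite subsetEset /F; apply: subset_itvr.
    by rewrite bnd_simp lef_pV2 ?posrE// ler_nat.
  - by move=> i; exact: measurable_itv.
  - move=> i; apply/measurable_EFinP; apply: measurable_funTS.
    exact: measurable_powR.
  - by move=> i x _; rewrite lee_fin powR_ge0.
rewrite -(cvg_lim _ H)//; apply: lime_le.
  by apply/cvg_ex; eexists; exact: H.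
apply: nearW => n.
have ip : mu.-integrable (F n) (EFin \o (fun y : R => y `^ (p - 1))).
  exact: integrable_powR.
rewrite -[leLHS]fineK; last by apply: integrable_fin_num; [exact: measurable_itv|exact: ip].
rewrite lee_fin.
have := @Rintegral_powR p n.+1%:R^-1 1.
rewrite /Rintegral => ->//; [|by rewrite gt_eqF|by rewrite invf_le1// ler1n].
rewrite powR1 -[leRHS]mul1r ler_pM2r ?invr_gt0//.
Qed.

Lemma integrable_powR01 p : 0 < p ->
  mu.-integrable `]0, 1] (EFin \o (fun y : R => y `^ (p - 1))).
Proof.
move=> p0; apply/integrableP; split.
  by apply/measurable_EFinP; apply: measurable_funTS; exact: measurable_powR.
rewrite (eq_integral (fun y : measurableTypeR R => ((y : R) `^ (p - 1))%:E)).
  by rewrite (le_lt_trans (integral_powR01 p0))// ltry.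
by move=> y _ /=; rewrite ger0_norm// powR_ge0.
Qed.

Lemma Rintegral_powR01 p : 0 < p ->
  \int[mu]_(y in `]0, 1]) (y `^ (p - 1)) <= p^-1.
Proof.
move=> p0; rewrite -lee_fin /Rintegral fineK ?integral_powR01//.
by apply: integrable_fin_num; [exact: measurable_itv|exact: integrable_powR01].
Qed.

End interval_integrals.

(** * The kernel: size, scaling, and L1 modulus of continuity in [x] *)

Section kernel.
Context {R : realType}.
Notation mu := (@lebesgue_measure R).
Implicit Types (x y : R) (g : R -> R).

Lemma Rintegral_itv_scale g t a b : 0 < t -> measurable_fun setT g ->
  mu.-integrable `]a / t, b / t] (EFin \o g) ->
  \int[mu]_(v in `]a, b]) g (v / t) = t * \int[mu]_(y in `]a / t, b / t]) g y.
Proof.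
move=> t0 mg; rewrite integrable_mkcond//= => ig.
rewrite [RHS]mulrC [in RHS]Rintegral_mkcond mulrC -Rintegral_scale//; last first.
  by rewrite -restrict_EFin.
rewrite [LHS]Rintegral_mkcond; apply: eq_Rintegral => v _.
rewrite !patchE; congr (if _ then _ else _).
by apply/idP/idP; rewrite !inE/= !in_itv/= ltr_pM2r ?invr_gt0// ler_pM2r ?invr_gt0.
Qed.

Lemma KE x y : 0 < x -> 0 < y ->
  K x y = 2^-1 - (x * y)^-1 + (Num.floor (x * y)^-1)%:~R.
Proof. by move=> x0 y0; rewrite /K x0 y0/= /frac opprB addrA addrAC. Qed.

Lemma K_le x y : `|K x y| <= 2^-1.
Proof.
rewrite /K; case: ifPn => [/andP[x0 y0]|_]; last by rewrite normr0.
rewrite /frac; have /andP := floor_itv (x * y)^-1; rewrite intrD.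
set a := (x * y)^-1; set b := (Num.floor a)%:~R => -[ba ab].
by rewrite ler_norml; lra.
Qed.

Lemma measurable_K x : measurable_fun [set: R] (K x).
Proof.
have [x0|x0] := ltP 0 x; last first.
  rewrite (_ : K x = cst 0); first exact: measurable_cst.
  by apply/funext => y; rewrite /K ltNge x0.
rewrite (_ : K x = (fun y => 2^-1 - frac (x * y)^-1) \_ `]0, +oo[); last first.
  apply/funext => y; rewrite patchE /K x0/=; congr (if _ then _ else _).
  by apply/idP/idP; rewrite inE/= in_itv/= andbT.
apply/(measurable_restrictT _ _).1 => //; apply: measurable_funTS.
apply: measurable_funB => //; apply: measurable_funB.
  by apply: (measurableT_comp measurable_inv); exact: measurable_funM.
apply: (measurableT_comp measurable_floor).
by apply: (measurableT_comp measurable_inv); exact: measurable_funM.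
Qed.

(** The kernel depends on the product of its arguments only. This lets a dilation of the integration
    variable be traded for a dilation of [x]. *)
Lemma K_scale t x y : 0 < t -> K (t * x) (y / t) = K x y.
Proof.
move=> t0; rewrite /K pmulr_rgt0// pmulr_lgt0 ?invr_gt0//.
by congr (if _ then _ - frac _^-1 else _); field; rewrite gt_eqF.
Qed.

Let floorK x y : R := (Num.floor (x * y)^-1)%:~R.

Let measurable_floorK x : measurable_fun [set: R] (floorK x).
Proof.
apply: (measurableT_comp measurable_floor).
by apply: (measurableT_comp measurable_inv); exact: measurable_funM.
Qed.

Let floorK_ge0 x y : 0 < x -> 0 < y -> 0 <= floorK x y.
Proof. by move=> x0 y0; rewrite /floorK ler0z floor_ge0 invr_ge0 mulr_ge0 ?ltW. Qed.

Let floorK_le x a y : 0 < x -> 0 < a -> a <= y -> floorK x y <= (x * a)^-1.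
Proof.
move=> x0 a0 ay; apply: (le_trans (floor_le _)).
by rewrite lef_pV2 ?posrE ?mulr_gt0// ?(lt_le_trans a0)// ler_pM2l.
Qed.

Let floorK_norm x a y : 0 < x -> 0 < a -> a < y -> `|floorK x y| <= (x * a)^-1.
Proof.
move=> x0 a0 ay; rewrite ger0_norm ?floorK_ge0// ?(lt_trans a0)//.
by rewrite floorK_le// ltW.
Qed.

Let integrable_floorK x a b : 0 < x -> 0 < a ->
  mu.-integrable `]a, b] (EFin \o floorK x).
Proof.
move=> x0 a0; apply: (@integrable_itv_bounded _ _ _ _ (x * a)^-1) => //.
by move=> y /andP[ay _]; exact: floorK_norm.
Qed.

(* Since [floor (x y)^-1] is monotone in [x], the L1 distance of its values at
   [x] and [x'] is a difference of integrals, which scaling makes small. *)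
Let floorK_diff x x' h : 0 < x -> x < x' -> x' <= 1 -> 0 < h -> h <= 1 ->
  x^-1 - x'^-1 <= 2^-1 ->
  \int[mu]_(y in `]h, 1]) floorK x y - \int[mu]_(y in `]h, 1]) floorK x' y
  <= (x^-1 - x'^-1) / h + 2 * (x^-1 - x'^-1).
Proof.
move=> x0 xx' x'1 h0 h1 r2; have x'0 : 0 < x' by exact: lt_trans xx'.
set r := x^-1 - x'^-1.
(* With this ratio [floorK x' y = floorK x (y / t)], so both integrals become integrals of the same
   function over shifted intervals. *)
pose t := x / x'.
have t0 : 0 < t by rewrite divr_gt0.
have t1 : t < 1 by rewrite /t ltr_pdivrMr// mul1r.
have rE : (1 - t) / x = r by rewrite /r /t; field; rewrite !gt_eqF.
have r0 : 0 < r by rewrite -rE divr_gt0// subr_gt0.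
have t2 : 2^-1 <= t.
  have : (1 - t) <= 2^-1 * x by rewrite -ler_pdivrMr// rE.
  have : 2^-1 * x <= 2^-1 by rewrite ger_pMr// ltW// (lt_le_trans xx').
  by lra.
have ht : h <= h / t by rewrite ler_pdivlMr// ger_pMr// ltW.
have -> : \int[mu]_(y in `]h, 1]) floorK x' y =
    t * \int[mu]_(y in `]h / t, 1 / t]) floorK x y.
  rewrite -Rintegral_itv_scale//; last by apply: integrable_floorK; rewrite ?divr_gt0.
  apply: eq_Rintegral => y _; rewrite /floorK /t; congr (_ (Num.floor _^-1)).
  by field; rewrite !gt_eqF.
have I0 a b : 0 < a -> 0 <= \int[mu]_(y in `]a, b]) floorK x y.
  move=> a0; apply: Rintegral_ge0 => y /=; rewrite in_itv/= => /andP[ay _].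
  by rewrite floorK_ge0// (lt_trans a0).
have Ile a b : 0 < a -> a <= b -> \int[mu]_(y in `]a, b]) floorK x y <= (x * a)^-1 * (b - a).
  move=> a0 ab; rewrite (le_trans (ler_norm _))// Rintegral_itv_bound// => y /andP[ay _].
  exact: floorK_norm.
have E1 : (x * h)^-1 * (h / t - h) <= 2 * r.
  have -> : (x * h)^-1 * (h / t - h) = r / t.
    by rewrite -rE; field; rewrite !gt_eqF.
  by rewrite ler_pdivrMr//; nra.
have rh0 : 0 <= r / h by rewrite divr_ge0 ?ltW.
(* If [h / t > 1] the first integral alone is at most [2 r]. Otherwise the intervals overlap in []h
   / t, 1]], which enters with the small weight [1 - t] and costs [r / h]; []h, h / t]] costs [2 r],
   and []1, 1 / t]] has a favourable sign. *)
have [ht1|ht1] := leP (h / t) 1; last first.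
  have A : \int[mu]_(y in `]h, 1]) floorK x y <= (x * h)^-1 * (h / t - h).
    rewrite (le_trans (Ile _ _ h0 h1))// ler_wpM2l ?invr_ge0 ?mulr_ge0 ?ltW//.
    by rewrite ltrD2r.
  have Z := mulr_ge0 (ltW t0) (I0 (h / t) (1 / t) (divr_gt0 h0 t0)).
  move: A Z; move: (Rintegral _ _ _) => I1; move: (Rintegral _ _ _) => I2 A Z.
  by lra.
have t1' : 1 <= 1 / t by rewrite ler_pdivlMr// mul1r ltW.
rewrite (@Rintegral_itv_split _ _ h (h / t) 1)//; last exact: integrable_floorK.
rewrite (@Rintegral_itv_split _ _ (h / t) 1 (1 / t))//; last first.
  by apply: integrable_floorK => //; rewrite divr_gt0.
set A := (X in X + _ - _); set B := (X in _ + X - _); set C := (X in t * (_ + X)).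
have HA : A <= 2 * r by rewrite (le_trans (Ile _ _ h0 ht)).
have HC : 0 <= t * C by apply: mulr_ge0; [exact: ltW|apply: I0].
have HB : (1 - t) * B <= r / h.
  have : B <= (x * h)^-1.
    rewrite (le_trans (ler_norm _))//.
    apply: (@le_trans _ _ ((x * h)^-1 * (1 - h / t))).
      apply: Rintegral_itv_bound => // y /andP[hy _]; apply: floorK_norm => //.
      exact: le_lt_trans hy.
    apply: ler_piMr; first by rewrite invr_ge0 mulr_ge0// ltW.
    by rewrite gerBl divr_ge0// ltW.
  have t1'' : 0 <= 1 - t by rewrite subr_ge0 ltW.
  by move=> /(ler_wpM2l t1'') H; rewrite (le_trans H)// invfM mulrA rE.
rewrite -/B; move: A B C HA HB HC => A B C HA HB HC; lra.
Qed.

(** Put [r = 1/x - 1/x'] and cut at [h = sqrt r]. Below [h] the integrand is at most 1; above [h] it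
    is at most [r / y <= h] plus the difference of the floors, whose integral is at most
    [r / h + 2 r]. As [r <= h], the sum is at most [5 h]. *)
Lemma Rintegral_K_diff x x' : 0 < x -> x <= x' -> x' <= 1 ->
  \int[mu]_(y in `]0, 1]) `|K x y - K x' y| <= 5 * Num.sqrt (x^-1 - x'^-1).
Proof.
move=> x0; rewrite le_eqVlt => /predU1P[<- _|xx' x'1].
  rewrite subrr sqrtr0 mulr0 (_ : \int[mu]_(y in `]0, 1]) `|K x y - K x y| = \int[mu]_(y in `]0, 1]) 0).
    by rewrite Rintegral_itv_cst// mul0r.
  by apply: eq_Rintegral => y _; rewrite subrr normr0.
have x'0 : 0 < x' by exact: lt_trans xx'.
set r := x^-1 - x'^-1.
have r0 : 0 < r by rewrite subr_gt0 ltf_pV2.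
have mD : measurable_fun setT (fun y => `|K x y - K x' y|).
  by apply: measurableT_comp => //; apply: measurable_funB; exact: measurable_K.
have KK y : `|K x y - K x' y| <= 1.
  have := K_le x y; have := K_le x' y; rewrite !ler_norml; lra.
have KK' y : `| `|K x y - K x' y| | <= 1 by rewrite normr_id.
(* For [r > 1/2] the trivial bound 1 suffices, since then [sqrt r > 1/2]. *)
have [r2|r2] := leP r 2^-1; last first.
  apply: (@le_trans _ _ (1 * (1 - 0))).
    by rewrite (le_trans (ler_norm _))//; apply: Rintegral_itv_bound.
  have : 2^-1 < Num.sqrt r.
    rewrite -[ltLHS]ger0_norm// -sqrtr_sqr ltr_sqrt// expr2; lra.
  lra.
set h := Num.sqrt r.
have h0 : 0 < h by rewrite sqrtr_gt0.
have hh : h * h = r by rewrite -expr2 sqr_sqrtr// ltW.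
have h1 : h <= 1 by rewrite leNgt; apply/negP => h1; nra.
rewrite (@Rintegral_itv_split _ _ 0 h 1) ?(ltW h0)//; last first.
  by apply: (@integrable_itv_bounded _ _ _ _ 1).
have A : \int[mu]_(y in `]0, h]) `|K x y - K x' y| <= h.
  rewrite -[leRHS]mul1r -[X in _ <= _ * X]subr0.
  by rewrite (le_trans (ler_norm _))//; apply: Rintegral_itv_bound => //; exact: ltW.
have B : \int[mu]_(y in `]h, 1]) `|K x y - K x' y| <=
   h + (\int[mu]_(y in `]h, 1]) floorK x y - \int[mu]_(y in `]h, 1]) floorK x' y).
  have ix := integrable_floorK 1 x0 h0.
  have ix' := integrable_floorK 1 x'0 h0.
  have ih := integrable_itv_cst h 1 h.
  have iB : mu.-integrable `]h, 1] (EFin \o (fun y => floorK x y - floorK x' y)).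
    by apply: (@integrableB _ _ _ mu `]h, 1] _ _ _ ix ix').
  apply: (@le_trans _ _ (\int[mu]_(y in `]h, 1]) (h + (floorK x y - floorK x' y)))); last first.
    rewrite RintegralD// RintegralB// Rintegral_itv_cst// lerD2r.
    by apply: ler_piMr; rewrite ?gerBl; exact: ltW.
  apply: le_Rintegral => //.
  - by apply: (@integrable_itv_bounded _ _ _ _ 1).
  - by apply: (@integrableD _ _ _ mu `]h, 1] _ _ _ ih iB).
  move=> y /=; rewrite in_itv/= => /andP[hy y1].
  have y0 : 0 < y by exact: lt_trans hy.
  rewrite !KE// -/(floorK x y) -/(floorK x' y).
  have F : floorK x' y <= floorK x y.
    rewrite /floorK ler_int le_floor// lef_pV2 ?posrE ?mulr_gt0//.
    by rewrite ler_pM2r// ltW.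
  have rE : (x * y)^-1 - (x' * y)^-1 = r / y by rewrite !invfM -mulrBl.
  have ry : r / y <= h by rewrite ler_pdivrMr// -hh ler_pM2l// ltW.
  have ry0 : 0 <= r / y by rewrite divr_ge0 ?ltW.
  rewrite ler_norml; apply/andP; split; lra.
have := floorK_diff x0 xx' x'1 h0 h1 r2; rewrite -/r.
have -> : r / h = h by rewrite -hh mulfK// gt_eqF.
have : r <= h by rewrite -hh ger_pMr.
lra.
Qed.

End kernel.

(** The truncation [Num.min y 1] continues [f] by the constant [f 1] beyond 1, which makes
    continuity at 1 two-sided. The bound survives because [1 / min z 1 = max (1/z) 1] and [max _ 1]
    is a contraction. *)
Lemma holder_inv_continuous {R : realType} (f : R -> R) (C x : R) :
  (forall x x', 0 < x <= 1 -> 0 < x' <= 1 ->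
    `|f x - f x'| <= C * Num.sqrt `|x^-1 - x'^-1|) ->
  0 < x -> {for x, continuous (fun y : R => f (Num.min y 1))}.
Proof.
move=> fC x0.
have C0 : 0 <= C.
  have := fC 1 2^-1; rewrite invr1 invrK.
  have -> : `|1 - 2| = 1 :> R by rewrite distrC ger0_norm; lra.
  by rewrite sqrtr1 mulr1 => /(_ _ _)/(le_trans (normr_ge0 _)); apply; lra.
apply/cvgrPdist_le => e e0 /=.
have : (fun y : R => C * Num.sqrt `|x^-1 - y^-1|) y @[y --> x] --> C * Num.sqrt `|x^-1 - x^-1|.
  apply: cvgM; first exact: cvg_cst.
  apply: continuous_cvg; first exact: sqrt_continuous.
  apply: cvg_norm; apply: cvgB; first exact: cvg_cst.
  by apply: cvgV => //; rewrite gt_eqF.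
rewrite subrr normr0 sqrtr0 mulr0 => /cvgrPdist_le /(_ _ e0) H.
near=> y.
have y0 : 0 < y by near: y; exact: lt_nbhsr.
have : `|0 - C * Num.sqrt `|x^-1 - y^-1| | <= e by near: y.
rewrite sub0r normrN ger0_norm ?mulr_ge0 ?sqrtr_ge0//; apply: le_trans.
have m (z : R) : 0 < z -> 0 < Num.min z 1 <= 1.
  by move=> z0; rewrite lt_min z0 ltr01/= ge_min lexx orbT.
apply: (le_trans (fC _ _ (m _ x0) (m _ y0))).
rewrite ler_wpM2l// ler_sqrt//.
have mV (z : R) : 0 < z -> (Num.min z 1)^-1 = Num.max z^-1 1.
  move=> z0; have [z1|z1] := leP z 1.
    by rewrite (max_idPl _)// invf_ge1.
  by rewrite invr1 (max_idPr _)// invf_le1 ?ltW.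
rewrite !mV// ler_norml.
have := ler_norm (x^-1 - y^-1); have := ler_norm (- (x^-1 - y^-1)); rewrite normrN.
by have [] := leP x^-1 1; have [] := leP y^-1 1; lra.
Unshelve. all: by end_near. Qed.

(** * First properties of a normalised eigenfunction: bound, modulus of continuity, Borel
    measurability *)

Section eigenfunction.
Context {R : realType}.
Notation mu := (@lebesgue_measure R).
Variables (phi : R -> R) (lam : R).
Hypothesis ephi : is_eigenfunction phi lam.
Hypothesis nphi : (\int[@leb R]_(y in (@I01 R)) ((phi y) ^+ 2)%:E = 1)%E.

Local Notation mleb := (@completed_lebesgue_measure R).

Let mphi : measurable_fun (@I01 R) (phi : LR R -> R).
Proof. by case: ephi. Qed.

Let phiE (x : R) : 0 <= x <= 1 -> phi x = lam * int01 (fun y => K x y * phi y).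
Proof. by case: ephi => _ _ _; apply. Qed.

Lemma measurable_I01 : measurable (@I01 R).
Proof. by apply: borel_lebesgue; exact: measurable_itv. Qed.

Let mI := measurable_I01.

Lemma borel_lebesgue_fun (u : R -> R) : measurable_fun [set: R] u ->
  measurable_fun (@I01 R) (u : LR R -> R).
Proof.
move=> mu' _ B mB; apply: measurableI => //.
by apply: borel_lebesgue; rewrite -[X in measurable X]setTI; exact: mu'.
Qed.

Let lebI : mleb (@I01 R) = 1%E.
Proof.
transitivity (mu [set` `[(0:R), 1%R]]); first by [].
by rewrite lebesgue_measure_itv/= lte_fin ltr01 oppr0 adde0.
Qed.

Let lebI_lt : (mleb (@I01 R) < +oo)%E.
Proof. by rewrite lebI ltry. Qed.

Let cst_int (c : R) : mleb.-integrable (@I01 R) (EFin \o (fun _ => c)).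
Proof.
apply: measurable_bounded_integrable => //.
by exists `|c|; split => // z cz y _ /=; exact: ltW.
Qed.

Let cst_Rint (c : R) : \int[mleb]_(y in @I01 R) c = c.
Proof. by rewrite Rintegral_cst// [X in fine X]lebI/= mulr1. Qed.

Let sqr_int : mleb.-integrable (@I01 R) (EFin \o (fun y => phi y ^+ 2)).
Proof.
apply/integrableP; split; first by apply/measurable_EFinP; exact: measurable_funX.
rewrite (eq_integral (fun y : LR R => (phi (y : R) ^+ 2)%:E)).
  by rewrite [X in (X < _)%E](_ : _ = 1%E) ?ltry.
by move=> y _ /=; rewrite ger0_norm// sqr_ge0.
Qed.

Let sqr_Rint : \int[mleb]_(y in @I01 R) phi y ^+ 2 = 1.
Proof. exact: (congr1 fine nphi). Qed.

Let dom_int (c : R) :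
  mleb.-integrable (@I01 R) (EFin \o (fun y => c * (1 + phi y ^+ 2))).
Proof.
exact: (integrableZl mI c (integrableD mI (cst_int 1) sqr_int)).
Qed.

(** Square integrability is used through [|phi| <= 1 + phi^2], the right-hand side being integrable
    on a space of mass 1. *)
Let mulphi_int (u : R -> R) c : measurable_fun [set: R] u -> (forall y, `|u y| <= c) ->
  mleb.-integrable (@I01 R) (EFin \o (fun y => u y * phi y)).
Proof.
move=> mu' uc; apply: le_integrable (dom_int c) => //.
  by apply/measurable_EFinP; apply: measurable_funM => //; exact: borel_lebesgue_fun.
move=> y _ /=; rewrite lee_fin normrM.
have c0 : 0 <= c by exact: le_trans (uc 0).
have p0 : 0 <= 1 + phi y ^+ 2 by rewrite addr_ge0// sqr_ge0.
rewrite [leRHS]ger0_norm ?mulr_ge0//.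
apply: ler_pM => //.
by rewrite -real_normK ?num_real//; have := normr_ge0 (phi y); nra.
Qed.

(** From [|K| <= 1/2] and [|phi| <= 1 + phi^2]: by the normalisation, the integral of
    [(1 + phi^2) / 2] is exactly 1. *)
Lemma eigenfunction_bound x : 0 <= x <= 1 -> `|phi x| <= `|lam|.
Proof.
move=> x01; rewrite phiE// normrM ler_piMr//.
have iK := mulphi_int (measurable_K x) (K_le x).
apply: (le_trans (le_normr_Rintegral mI iK)).
apply: (@le_trans _ _ (\int[mleb]_(y in @I01 R) (2^-1 * (1 + phi y ^+ 2)))); last first.
  rewrite RintegralZl//; last exact: (integrableD mI (cst_int 1) sqr_int).
  rewrite RintegralD//.
  by rewrite cst_Rint sqr_Rint; lra.
apply: le_Rintegral => //; first exact: integrable_norm iK.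
move=> y _; rewrite normrM; apply: ler_pM => //; first exact: K_le.
by rewrite -[in leRHS]real_normK ?num_real//; have := normr_ge0 (phi y); nra.
Qed.

Lemma int01_borel (g : R -> R) : measurable_fun [set: R] g ->
  int01 g = \int[mu]_(y in `]0, 1]) g y.
Proof.
move=> mg; have mg' (D : set R) : measurable_fun D (EFin \o g).
  by apply/measurable_EFinP; exact: measurable_funTS.
rewrite /int01 /Rintegral (integral_leb _ (mg' _)); last exact: measurable_itv.
congr fine; apply/esym; exact: integral_itv_obnd_cbnd.
Qed.

(** One factor [lam] comes from the eigenvalue equation, the other from the bound on [phi]; what
    remains is the L1 distance of [K x] and [K x']. *)
Lemma eigenfunction_holder x x' : 0 < x <= 1 -> 0 < x' <= 1 ->
  `|phi x - phi x'| <= 5 * lam ^+ 2 * Num.sqrt `|x^-1 - x'^-1|.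
Proof.
wlog : x x' / x <= x'.
  move=> W hx hx'; have [xx'|/ltW x'x] := leP x x'; first exact: W.
  by rewrite distrC (distrC x^-1); exact: W.
move=> xx' /andP[x0 x1] /andP[x'0 x'1].
have iK z := mulphi_int (measurable_K z) (K_le z).
have mK : measurable_fun [set: R] (fun y => K x y - K x' y).
  by apply: measurable_funB; exact: measurable_K.
have KK y : `|K x y - K x' y| <= 1.
  by have := K_le x y; have := K_le x' y; rewrite !ler_norml; lra.
have iKK := mulphi_int mK KK.
rewrite phiE ?(ltW x0)// (phiE (x := x')) ?(ltW x'0)// -mulrBr.
have -> : int01 (fun y => K x y * phi y) - int01 (fun y => K x' y * phi y) =
    int01 (fun y => (K x y - K x' y) * phi y).
  rewrite /int01 -(RintegralB mI (iK x) (iK x')).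
  by apply: eq_Rintegral => y _; rewrite mulrBl.
rewrite normrM -[lam ^+ 2]real_normK ?num_real// expr2 mulrCA -2!mulrA.
rewrite ler_wpM2l//.
apply: (le_trans (le_normr_Rintegral mI iKK)).
apply: (@le_trans _ _ (\int[mleb]_(y in @I01 R) (`|lam| * `|K x y - K x' y|))).
  have mN : measurable_fun [set: R] (fun y => `|lam| * `|K x y - K x' y|).
    by apply: measurable_funM => //; exact: measurableT_comp.
  apply: le_Rintegral => //; first exact: integrable_norm iKK.
    apply: measurable_bounded_integrable => //; first exact: borel_lebesgue_fun.
    exists `|lam|; split => // z cz y _ /=.
    rewrite normrM !normr_id (le_trans _ (ltW cz))//.
    by rewrite ler_piMr.
  move=> y yI; rewrite normrM mulrC ler_wpM2r//.
  by apply: eigenfunction_bound; move: yI; rewrite /I01/= in_itv.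
have mN : measurable_fun [set: R] (fun y => `|K x y - K x' y|).
  exact: measurableT_comp.
have := @int01_borel (fun y => `|lam| * `|K x y - K x' y|).
rewrite /int01 /leb => ->; last exact: measurable_funM.
rewrite RintegralZl//; last first.
  by apply: (@integrable_itv_bounded _ _ _ _ 1) => // y _; rewrite normr_id.
rewrite mulrCA ler_wpM2l// ger0_norm; last by rewrite subr_ge0 lef_pV2.
exact: Rintegral_K_diff.
Qed.

Let f : R -> R := phi \_ `]0, 1].

(** [phi] is given as Lebesgue measurable only. Continuity on the open half-line upgrades this to
    Borel measurability of the restriction, after which the Borel Lebesgue measure can be used
    throughout. *)
Lemma eigenfunction_measurable : measurable_fun [set: R] f.
Proof.
pose g (x : R) := phi (Num.min x 1).
rewrite (_ : f = g \_ `]0, 1]); last first.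
  apply/funext => y; rewrite /f !patchE; case: ifPn => //.
  by rewrite inE/= in_itv/= => /andP[_ y1]; rewrite /g (min_idPl y1).
apply/(measurable_restrictT _ _).1 => //.
apply: (@measurable_funS _ _ (measurableTypeR R) _ [set` `]0, +oo[]) => //.
  by move=> y /=; rewrite !in_itv/= andbT => /andP[].
apply: open_continuous_measurable_fun; first exact: interval_open.
move=> x; rewrite inE/= in_itv/= andbT => x0.
exact: (holder_inv_continuous eigenfunction_holder x0).
Qed.

Lemma eigenfunctionE x : 0 < x <= 1 ->
  f x = lam * \int[mu]_(y in `]0, 1]) (K x y * f y).
Proof.
move=> /andP[x0 x1]; have mf := eigenfunction_measurable.
rewrite -int01_borel; last by apply: measurable_funM => //; exact: measurable_K.
rewrite /f patchE mem_set ?phiE ?(ltW x0)//; last by rewrite /= in_itv/= x0.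
congr (lam * _); apply: eq_Rintegral => y; rewrite inE /I01/= in_itv/= => /andP[y0 y1].
(* The closed interval also contains [y = 0], where the kernel is 0 by convention. *)
rewrite patchE; case: ifPn => //; rewrite notin_setE/= in_itv/= y1 andbT.
by move=> /negP; rewrite -leNgt => y0'; rewrite /K !ltNge y0' andbF !mul0r.
Qed.

End eigenfunction.

(** * The blocks between consecutive discontinuities of the kernel *)

Section blocks.
Context {R : realType}.
Notation mu := (@lebesgue_measure R).
Implicit Types (x y a b : R) (n m N : nat).

Lemma powRN2 y : 0 <= y -> y `^ (-1 - 1) = (y * y)^-1.
Proof.
move=> y0; have -> : -1 - 1 = - 2%:R :> R by lra.
by rewrite powR_invn// expr2.
Qed.

Lemma powRN3 y : 0 <= y -> y `^ (-2 - 1) = (y * y * y)^-1.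
Proof.
move=> y0; have -> : -2 - 1 = - 3%:R :> R by lra.
by rewrite powR_invn// exprS expr2 mulrA.
Qed.

(** Here [m.+1] is the index of the first node in []0, 1]]. The remainder of []0, 1]] above that
    node has length at most [x]. *)
Lemma ex_block x : 0 < x -> exists m, m%:R * x < 1 /\ 1 <= m.+1%:R * x.
Proof.
move=> x0.
have H : exists n, 1 <= n%:R * x.
  exists (Num.truncn x^-1).+1; rewrite -ler_pdivrMr// div1r.
  by apply: ltW; exact: truncnS_gt.
have [[|m] Hm Hmin] := ex_minnP H; first by move: Hm; rewrite mul0r ler10.
exists m; split => //; rewrite ltNge; apply/negP => /Hmin.
by rewrite ltnn.
Qed.

(* The discontinuities of [K x]. *)
Definition node x n : R := (n%:R * x)^-1.

Lemma node_gt0 x n : 0 < x -> (0 < n)%N -> 0 < node x n.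
Proof. by move=> x0 n0; rewrite invr_gt0 mulr_gt0// ltr0n. Qed.

Lemma node_le x n m : 0 < x -> (0 < n)%N -> (n <= m)%N -> node x m <= node x n.
Proof.
move=> x0 n0 nm; have m0 := leq_trans n0 nm.
by rewrite lef_pV2 ?posrE ?mulr_gt0 ?ltr0n// ler_pM2r// ler_nat.
Qed.

Lemma node_small x e : 0 < x -> 0 < e ->
  exists2 N0, (0 < N0)%N & forall N, (N0 <= N)%N -> node x N <= e.
Proof.
move=> x0 e0; exists (Num.truncn (e * x)^-1).+1 => // N hN.
rewrite /node invf_ple ?posrE ?mulr_gt0 ?ltr0n ?(leq_trans _ hN)//.
rewrite -ler_pdivrMr// -invfM; apply: ltW.
by apply: (lt_le_trans (truncnS_gt _)); rewrite ler_nat.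
Qed.

Lemma nodeV x n : (node x n)^-1 = n%:R * x. Proof. by rewrite invrK. Qed.

Lemma node_succ_itv x n y : 0 < x -> (0 < n)%N -> node x n.+1 < y <= node x n ->
  [/\ 0 < y, n%:R * x <= y^-1 & y^-1 < n.+1%:R * x].
Proof.
move=> x0 n0 /andP[ny yn].
have y0 : 0 < y by rewrite (lt_trans _ ny)// node_gt0.
split => //.
  by rewrite -[leLHS]invrK lef_pV2 ?posrE ?node_gt0.
by rewrite -[ltRHS]invrK ltf_pV2 ?posrE ?node_gt0.
Qed.

Lemma K_block x n y : 0 < x -> (0 < n)%N -> node x n.+1 < y <= node x n ->
  K x y = 2^-1 + n%:R - (x * y)^-1.
Proof.
move=> x0 n0 /(node_succ_itv x0 n0)[y0 h1 h2]; rewrite KE//.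
rewrite (@floor_def _ _ n%:Z); first by rewrite -pmulrn; ring.
rewrite intrD -pmulrn mulrC.
rewrite -[(_ + 1)]/(n%:R + 1) invfM.
by rewrite ler_pdivlMr// ltr_pdivrMr// h1 natr1 h2.
Qed.

(** In the variable [1/y] the nodes are the equally spaced points [n x], and [dy / y^2] is Lebesgue
    measure. *)
Lemma Rintegral_block_sqr x n : 0 < x -> (0 < n)%N ->
  \int[mu]_(y in `]node x n.+1, node x n]) (y `^ (-1 - 1)) = x.
Proof.
move=> x0 n0; have a0 := node_gt0 x0 (ltn0Sn n); have b0 := node_gt0 x0 n0.
have ab := node_le x0 n0 (leqnSn n).
rewrite Rintegral_powR//.
by rewrite !powR_inv1 ?(ltW a0) ?(ltW b0)// !nodeV -natr1; field.
Qed.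

(** With [u = 1/(x y)] this is, up to a factor, the integral of [1/2 - {u}] over a full period. The
    proof evaluates the two powers explicitly. *)
Lemma Rintegral_block_K x n : 0 < x -> (0 < n)%N ->
  \int[mu]_(y in `]node x n.+1, node x n]) (K x y * y `^ (-1 - 1)) = 0.
Proof.
move=> x0 n0.
have a0 := node_gt0 x0 (ltn0Sn n); have b0 := node_gt0 x0 n0.
have ab := node_le x0 n0 (leqnSn n).
transitivity (\int[mu]_(y in `]node x n.+1, node x n])
    ((2^-1 + n%:R) * y `^ (-1 - 1) - x^-1 * y `^ (-2 - 1))).
  apply: eq_Rintegral => y; rewrite inE/= in_itv/= => yab.
  have y0 : 0 < y by have [] := node_succ_itv x0 n0 yab.
  rewrite (K_block x0 n0 yab) powRN2 ?powRN3 ?ltW//.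
  by field; rewrite !gt_eqF.
have i2 := integrable_powR (-1 - 1) (node x n) a0.
have i3 := integrable_powR (-2 - 1) (node x n) a0.
rewrite RintegralB//; last 2 first.
  exact: (integrableZl _ _ i2).
  exact: (integrableZl _ _ i3).
rewrite !RintegralZl// Rintegral_block_sqr//.
rewrite Rintegral_powR//.
have P (z : R) : 0 < z -> z `^ (-2) = z^-1 ^+ 2.
  by move=> z0; rewrite (powR_invn 2) ?ltW// exprVn.
rewrite !P// !nodeV -natr1; field.
by rewrite gt_eqF.
Qed.

(** On a block [1/y] varies by at most [x], and [y - a = (1/a - 1/y) y a]. *)
Lemma block_diff x n y : 0 < x -> (0 < n)%N -> node x n <= 1 ->
  node x n.+1 < y <= node x n ->
  let a := node x n.+1 in [/\ 0 < a, 0 < y, a <= y, y <= 1 & y - a <= x * (y * a)].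
Proof.
move=> x0 n0 n1 yn a; have [y0 h1 h2] := node_succ_itv x0 n0 yn.
move: yn => /andP[y1 y2].
have a0 : 0 < a := node_gt0 x0 (ltn0Sn n).
split => //; [exact: ltW|exact: le_trans n1|].
have -> : y - a = (a^-1 - y^-1) * (y * a) by field; rewrite !gt_eqF.
rewrite ler_pM2r ?mulr_gt0// nodeV.
by move: h1; rewrite -natr1; lra.
Qed.

End blocks.

(** * Decay of order [sqrt x] at the origin *)

Section profile.
Context {R : realType}.
Notation mu := (@lebesgue_measure R).
Variables (f : R -> R) (M C lam : R).
Hypothesis mf : measurable_fun [set: R] f.
Hypothesis f0 : forall y, ~~ (0 < y <= 1) -> f y = 0.
Hypothesis fM : forall y, `|f y| <= M.
Hypothesis fC : forall x x', 0 < x <= 1 -> 0 < x' <= 1 ->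
  `|f x - f x'| <= C * Num.sqrt `|x^-1 - x'^-1|.
Hypothesis fE : forall x, 0 < x <= 1 ->
  f x = lam * \int[mu]_(y in `]0, 1]) (K x y * f y).
Implicit Types (x y a b : R) (n m N : nat).

Let M0 : 0 <= M. Proof. exact: le_trans (fM 0). Qed.

Lemma holder_cst_ge0 : 0 <= C.
Proof.
have := fC (x := 1) (x' := 2^-1); rewrite invr1 invrK.
have -> : `|1 - 2| = 1 :> R by rewrite distrC ger0_norm; lra.
by rewrite sqrtr1 mulr1 => /(_ _ _)/(le_trans (normr_ge0 _)); apply; lra.
Qed.

Let mKf x : measurable_fun [set: R] (fun y => K x y * f y).
Proof. by apply: measurable_funM => //; exact: measurable_K. Qed.

Let Kf_le x y : `|K x y * f y| <= M / 2.
Proof. by rewrite normrM mulrC ler_pM// K_le. Qed.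

Let C0 := holder_cst_ge0.

Lemma block_osc x n y : 0 < x -> (0 < n)%N -> node x n <= 1 ->
  node x n.+1 < y <= node x n -> `|f y - f (node x n.+1)| <= C * Num.sqrt x.
Proof.
move=> x0 n0 n1 yn; have [y0 h1 h2] := node_succ_itv x0 n0 yn.
move: yn => /andP[y1 y2].
have a0 := node_gt0 x0 (ltn0Sn n).
apply: (le_trans (fC _ _)).
- by rewrite y0 (le_trans y2).
- by rewrite a0 (le_trans (ltW y1))// (le_trans y2).
rewrite ler_wpM2l// ler_sqrt; last exact: ltW.
rewrite nodeV distrC gtr0_norm ?subr_gt0//.
by move: h1; rewrite -natr1; lra.
Qed.

(** The multiple [a^2 f(a)] of the mean-zero function [K x y / y^2] can be subtracted freely. It
    leaves [K x y] times [f(y) - f(a)], at most [C sqrt x], plus [f(a) (1 - a^2 / y^2)], at most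
    [2 M x]. *)
Let decay_block x n : 0 < x -> (0 < n)%N -> node x n <= 1 ->
  `|\int[mu]_(y in `]node x n.+1, node x n]) (K x y * f y)| <=
  (C * Num.sqrt x + 2 * M * x) / 2 * (node x n - node x n.+1).
Proof.
move=> x0 n0 n1; set a := node x n.+1; set b := node x n.
have a0 : 0 < a := node_gt0 x0 (ltn0Sn n).
have ab : a <= b := node_le x0 n0 (leqnSn n).
have iKf : mu.-integrable `]a, b] (EFin \o (fun y => K x y * f y)).
  by apply: integrable_itv_bounded => //.
have iK : mu.-integrable `]a, b] (EFin \o (fun y => K x y * y `^ (-1 - 1))).
  apply: (@integrable_itv_bounded _ _ _ _ (2^-1 * (a * a)^-1)).
    by apply: measurable_funM; [exact: measurable_K|exact: measurable_powR].
  move=> y /andP[ay _]; have y0 := lt_trans a0 ay.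
  rewrite normrM ler_pM ?K_le// powRN2 ?(ltW y0)// ger0_norm ?invr_ge0 ?mulr_ge0 ?(ltW y0)//.
  by rewrite lef_pV2 ?posrE ?mulr_gt0// ler_pM ?(ltW a0) ?(ltW ay).
have -> : \int[mu]_(y in `]a, b]) (K x y * f y) =
    \int[mu]_(y in `]a, b]) (K x y * f y - a ^+ 2 * f a * (K x y * y `^ (-1 - 1))).
  rewrite RintegralB//; last exact: (integrableZl _ _ iK).
  by rewrite RintegralZl// Rintegral_block_K// mulr0 subr0.
apply: Rintegral_itv_bound => //.
  apply: measurable_funB => //; apply: measurable_funM => //.
  by apply: measurable_funM; [exact: measurable_K|exact: measurable_powR].
move=> y yab; have := block_osc x0 n0 n1 yab.
have [_ y0 ay y1 ya] := block_diff x0 n0 n1 yab.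
rewrite -/a => osc; rewrite powRN2 ?(ltW y0)//.
have -> : K x y * f y - a ^+ 2 * f a * (K x y * (y * y)^-1) =
    K x y * ((f y - f a) + f a * ((y - a) * (y + a)) / (y * y)).
  by field; rewrite gt_eqF.
rewrite normrM mulrC ler_pM ?K_le//.
apply: (le_trans (ler_normD _ _)); apply: lerD => //.
rewrite normrM normrM.
rewrite (ger0_norm (x := _^-1)) ?invr_ge0 ?mulr_ge0 ?(ltW y0)//.
rewrite ler_pdivrMr ?mulr_gt0//.
rewrite (ger0_norm (x := (y - a) * _)); last first.
  by rewrite mulr_ge0 ?subr_ge0// addr_ge0 ?(ltW y0) ?(ltW a0).
have : (y - a) * (y + a) <= 2 * x * (y * y).
  apply: (@le_trans _ _ (x * (y * a) * (y + a))).
    by rewrite ler_wpM2r// addr_ge0 ?(ltW y0) ?(ltW a0).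
  have h : a * (y + a) <= 1 * (y + y).
    by rewrite ler_pM ?lerD// ?addr_ge0 ?(ltW y0) ?(ltW a0)// (le_trans ay).
  have := ler_wpM2l (mulr_ge0 (ltW x0) (ltW y0)) h.
  lra.
move=> h.
have h0 : 0 <= (y - a) * (y + a).
  by rewrite mulr_ge0 ?subr_ge0// addr_ge0 ?(ltW y0) ?(ltW a0).
by apply: (le_trans (ler_pM (normr_ge0 (f a)) h0 (fM a) h)); lra.
Qed.

Let decay_blocks x m k : 0 < x -> (0 < m)%N -> node x m <= 1 ->
  `|\int[mu]_(y in `]node x (m + k), node x m]) (K x y * f y)| <=
  (C * Num.sqrt x + 2 * M * x) / 2 * (node x m - node x (m + k)).
Proof.
move=> x0 m0 m1; elim: k => [|k IH].
  by rewrite addn0 set_itvoc0 Rintegral_set0 subrr mulr0 normr0.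
have mk0 : (0 < m + k)%N by rewrite addn_gt0 m0.
have L1 := node_le x0 mk0 (leqnSn (m + k)).
have L2 := node_le x0 m0 (leq_addr k m).
rewrite addnS (Rintegral_itv_split L1 L2); last by apply: integrable_itv_bounded.
apply: (le_trans (ler_normD _ _)).
have D := decay_block x0 mk0 (le_trans L2 m1).
apply: (le_trans (lerD D IH)).
by rewrite -mulrDr [X in _ * X]addrC addrA subrK.
Qed.

Definition decay_cst := `|lam| * (C + 2 * M).

Lemma decay_cst_ge0 : 0 <= decay_cst.
Proof. by rewrite mulr_ge0// addr_ge0// mulr_ge0. Qed.

Lemma decay x : 0 < x <= 1 -> `|f x| <= decay_cst * Num.sqrt x.
Proof.
move=> /andP[x0 x1].
rewrite fE ?x0// normrM /decay_cst -mulrA ler_wpM2l//.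
have [m [mx mx1]] := ex_block x0.
have sx0 := sqrtr_ge0 x.
have xs : x <= Num.sqrt x.
  rewrite -[X in X <= _](@sqr_sqrtr _ x) ?(ltW x0)// expr2 ler_piMr//.
  by rewrite -sqrtr1 ler_sqrt.
have c0 := node_gt0 x0 (ltn0Sn m); set c := node x m.+1 in c0.
have c1 : c <= 1 by rewrite invf_le1// mulr_gt0.
have c1x : 1 - c <= x.
  have -> : 1 - c = (m.+1%:R * x - 1) * c.
    by rewrite mulrBl mul1r /c /node divff// mulf_neq0// ?pnatr_eq0// gt_eqF.
  rewrite -[leRHS]mulr1; apply: ler_pM => //; [by rewrite subr_ge0|exact: ltW|].
  by rewrite -natr1; lra.
(* The interval is cut at a node near 0 and at the first node [c]. Below the small node boundedness
   of [f] costs at most [e]; the middle consists of whole blocks; []c, 1]] has length at most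
   [x]. *)
apply/ler_addgt0Pr => e e0.
have M1 : 0 < M + 1 by rewrite ltr_wpDl.
have [N0 N00 hN] := node_small x0 (divr_gt0 e0 M1).
pose k := N0.
have kN : node x (m.+1 + k) <= e / (M + 1) by apply: hN; exact: leq_addl.
have k0 : 0 < node x (m.+1 + k) by exact: node_gt0.
have kc : node x (m.+1 + k) <= c by apply: node_le => //; exact: leq_addr.
rewrite (Rintegral_itv_split (ltW k0) (le_trans kc c1)); last by apply: integrable_itv_bounded.
rewrite (Rintegral_itv_split kc c1); last by apply: integrable_itv_bounded.
have I1 : `|\int[mu]_(y in `]0, node x (m.+1 + k)]) (K x y * f y)| <= e.
  apply: (@le_trans _ _ (M / 2 * (node x (m.+1 + k) - 0))).
    by apply: Rintegral_itv_bound => //; exact: ltW.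
  rewrite subr0; apply: (@le_trans _ _ ((M + 1) * (e / (M + 1)))).
    apply: ler_pM kN; [by rewrite divr_ge0|exact: ltW|].
    by have := M0; lra.
  by rewrite mulrCA divff ?mulr1// gt_eqF.
have I2 : `|\int[mu]_(y in `]node x (m.+1 + k), c]) (K x y * f y)| <=
    (C * Num.sqrt x + 2 * M * x) / 2.
  apply: (le_trans (decay_blocks k x0 (ltn0Sn m) c1)).
  apply: ler_piMr; last by rewrite -/c; lra.
  by rewrite mulr_ge0// addr_ge0// ?mulr_ge0// ltW.
have I3 : `|\int[mu]_(y in `]c, 1]) (K x y * f y)| <= M / 2 * x.
  apply: (@le_trans _ _ (M / 2 * (1 - c))).
    by apply: Rintegral_itv_bound.
  by rewrite ler_wpM2l// divr_ge0.
apply: (le_trans (ler_normD _ _)); rewrite [leRHS]addrC; apply: lerD => //.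
apply: (le_trans (ler_normD _ _)); apply: (le_trans (lerD I2 I3)).
have : M * x <= M * Num.sqrt x by rewrite ler_wpM2l.
have : 0 <= C * Num.sqrt x by rewrite mulr_ge0.
have : 0 <= M * x by rewrite mulr_ge0// ltW.
lra.
Qed.

End profile.

(** * Quadrature error for the integral of [f(y) / y] *)

Section density.
Context {R : realType}.
Notation mu := (@lebesgue_measure R).
Variables (f : R -> R) (M C D : R).
Hypothesis mf : measurable_fun [set: R] f.
Hypothesis f0 : forall y, ~~ (0 < y <= 1) -> f y = 0.
Hypothesis fM : forall y, `|f y| <= M.
Hypothesis fC : forall x x', 0 < x <= 1 -> 0 < x' <= 1 ->
  `|f x - f x'| <= C * Num.sqrt `|x^-1 - x'^-1|.
Hypothesis D0 : 0 <= D.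
Hypothesis fD : forall x, 0 < x <= 1 -> `|f x| <= D * Num.sqrt x.
Implicit Types (x y a b : R) (n m N : nat).

Local Notation q x := (x `^ 4^-1).

Let M0 : 0 <= M. Proof. exact: le_trans (fM 0). Qed.
Let C0 : 0 <= C := holder_cst_ge0 fC.

Lemma powR4_sqr x : 0 <= x -> q x * q x = Num.sqrt x.
Proof.
move=> x0; rewrite -powR12_sqrt// -powRD; first by congr (_ `^ _); lra.
by apply/implyP => /eqP; lra.
Qed.


Lemma powR4_le x y : 0 <= x -> x <= y -> q x <= q y.
Proof.
move=> x0 xy; apply: ge0_ler_powR; rewrite ?nnegrE//.
exact: le_trans xy.
Qed.

Lemma powR4_div y : 0 < y -> y `^ (4^-1 - 1) = q y / y.
Proof.
move=> y0; rewrite powRB ?powRr1 ?(ltW y0)//.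
by rewrite (gt_eqF y0) implybT.
Qed.

Lemma le_powR4 x : 0 < x -> x <= 1 -> x <= q x.
Proof. by move=> x0 x1; apply: ger1_powR; rewrite ?x0//; lra. Qed.

Let mfy : measurable_fun [set: R] (fun y => f y / y).
Proof. by apply: measurable_funM => //; exact: measurable_inv. Qed.

Let mpow : measurable_fun [set: R] (fun y : R => y `^ (4^-1 - 1)).
Proof. exact: measurable_powR. Qed.

Let pow_int t : t <= 1 -> mu.-integrable `]0, t] (EFin \o (fun y : R => y `^ (4^-1 - 1))).
Proof.
move=> t1; apply: (@integrableS _ _ _ mu `]0, 1]) => //.
  by apply: subset_itvl; rewrite bnd_simp.
exact: integrable_powR01.
Qed.

(** The constant 4 is [1/p] for [p = 1/4]. *)
Let pow_Rint a b : 0 <= a -> a <= b -> b <= 1 ->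
  \int[mu]_(y in `]a, b]) (y `^ (4^-1 - 1)) <= 4.
Proof.
move=> a0 ab b1; apply: (@le_trans _ _ (\int[mu]_(y in `]0, 1]) (y `^ (4^-1 - 1)))).
  have p0 (c d : R) : 0 <= \int[mu]_(y in `]c, d]) (y `^ (4^-1 - 1)).
    by apply: Rintegral_ge0 => y _; exact: powR_ge0.
  rewrite (Rintegral_itv_split (a := 0) (b := b) (c := 1))//; [|exact: le_trans ab|exact: pow_int].
  rewrite (Rintegral_itv_split (a := 0) (b := a) (c := b))//; [|exact: pow_int].
  by rewrite addrAC lerDr addr_ge0.
rewrite (le_trans (Rintegral_powR01 _))// invrK.
by [].
Qed.

(** The decay [sqrt y] is spent in two halves: one fourth root gives smallness in [t], the other
    makes [y^(1/4 - 1)] integrable at 0. *)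
Let fy_le t y : t <= 1 -> 0 < y <= t -> `|f y / y| <= D * q t * y `^ (4^-1 - 1).
Proof.
move=> t1 /andP[y0 yt]; rewrite powR4_div// normrM (ger0_norm (x := y^-1)) ?invr_ge0 ?(ltW y0)//.
rewrite mulrA ler_pM2r ?invr_gt0//.
have y1 := le_trans yt t1.
rewrite (le_trans (fD _)) ?y0// -powR4_sqr ?(ltW y0)// mulrA.
by rewrite ler_wpM2r ?powR_ge0// ler_wpM2l// powR4_le// ltW.
Qed.

Lemma integrable_div t : t <= 1 -> mu.-integrable `]0, t] (EFin \o (fun y => f y / y)).
Proof.
move=> t1; apply: (@le_integrable _ _ _ mu _ _ _
    (EFin \o (fun y => D * q t * y `^ (4^-1 - 1)))) => //.
- by apply/measurable_EFinP; exact: measurable_funTS.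
- move=> y; rewrite /= in_itv/= => yt; rewrite lee_fin (le_trans (fy_le t1 yt))//.
  exact: ler_norm.
- exact: (integrableZl _ _ (pow_int t1)).
Qed.

Lemma Rintegral_div_tail t : 0 <= t -> t <= 1 ->
  `|\int[mu]_(y in `]0, t]) (f y / y)| <= 4 * D * q t.
Proof.
move=> t0 t1; have ifd := integrable_div t1.
apply: (le_trans (le_normr_Rintegral _ ifd)) => //.
have := pow_Rint (lexx 0) t0 t1.
move=> /(ler_wpM2l (mulr_ge0 D0 (powR_ge0 t 4^-1))) H.
apply: le_trans (le_trans H _); last by rewrite mulrC mulrA.
rewrite -RintegralZl//; last exact: pow_int.
apply: le_Rintegral => //.
- exact: integrable_norm ifd.
- exact: (integrableZl _ _ (pow_int t1)).
- by move=> y; rewrite /= in_itv/= => yt; exact: fy_le.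
Qed.

Let B := C + 2 * D.
Let B0 : 0 <= B. Proof. by rewrite addr_ge0// mulr_ge0. Qed.

(** The oscillation is at most [C sqrt x] by the Hölder bound and at most [2 D sqrt y] by decay. The
    smaller of the two is controlled by the geometric mean of [sqrt x] and [sqrt y]. *)
Let osc4 x n y : 0 < x -> (0 < n)%N -> node x n <= 1 ->
  node x n.+1 < y <= node x n -> `|f y - f (node x n.+1)| <= B * (q x * q y).
Proof.
move=> x0 n0 n1 yn; have [a0 y0 ay y1 ya] := block_diff x0 n0 n1 yn.
set a := node x n.+1 in a0 ay ya *.
have h1 := block_osc fC x0 n0 n1 yn; rewrite -/a in h1.
have h2 : `|f y - f a| <= 2 * D * Num.sqrt y.
  apply: (le_trans (ler_normB _ _)).
  have ha : `|f a| <= D * Num.sqrt y.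
    apply: (le_trans (fD _)); first by rewrite a0 (le_trans ay).
    by rewrite ler_wpM2l// ler_sqrt// ltW.
  have hy : `|f y| <= D * Num.sqrt y by apply: fD; rewrite y0.
  lra.
have p0 := powR_ge0 x 4^-1; have s0 := powR_ge0 y 4^-1.
move: h1 h2; rewrite -!powR4_sqr ?(ltW x0) ?(ltW y0)// /B.
move: (q x) (q y) p0 s0 => p s p0 s0 h1 h2.
have [ps|sp] := leP p s.
  have : C * (p * p) <= C * (p * s) by rewrite !ler_wpM2l.
  have : 0 <= D * (p * s) by rewrite !mulr_ge0.
  lra.
have : D * (s * s) <= D * (p * s) by rewrite ler_wpM2l// ler_wpM2r// ltW.
have : 0 <= C * (p * s) by rewrite !mulr_ge0.
lra.
Qed.

(** Pointwise majorant of the quadrature error: the first term comes from the oscillation of [f] on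
    a block, the second from replacing [1/y] by [a / y^2]. *)
Let bnd x y : R := B * q x * y `^ (4^-1 - 1) + M * x.

Let bnd_int x a b : 0 <= a -> b <= 1 -> mu.-integrable `]a, b] (EFin \o bnd x).
Proof.
move=> a0 b1; apply: (@integrableS _ _ _ mu `]0, b]) => //.
  by apply: subset_itvr; rewrite bnd_simp.
exact: (integrableD _ (integrableZl _ _ (pow_int b1)) (integrable_itv_cst 0 b (M * x))).
Qed.

(** Since [a = 1/((n+1) x)] and [1/y^2] has integral [x] over the block, [f(a) / (n+1)] is the
    integral of [a f(a) / y^2], to be compared with [f(y) / y] pointwise. *)
Let block4 x n : 0 < x -> (0 < n)%N -> node x n <= 1 ->
  `|\int[mu]_(y in `]node x n.+1, node x n]) (f y / y) - f (node x n.+1) / n.+1%:R|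
  <= \int[mu]_(y in `]node x n.+1, node x n]) bnd x y.
Proof.
move=> x0 n0 n1; set a := node x n.+1; set b := node x n.
have a0 : 0 < a := node_gt0 x0 (ltn0Sn n).
have ab : a <= b := node_le x0 n0 (leqnSn n).
have ify : mu.-integrable `]a, b] (EFin \o (fun y => f y / y)).
  apply: (integrableS _ _ _ (integrable_div n1)) => //.
  by apply: subset_itvr; rewrite bnd_simp ltW.
have i2 := integrable_powR (-1 - 1) b a0.
have E : \int[mu]_(y in `]a, b]) (f y / y) - f a / n.+1%:R =
    \int[mu]_(y in `]a, b]) (f y / y - a * f a * y `^ (-1 - 1)).
  rewrite RintegralB//; last exact: (integrableZl _ _ i2).
  rewrite RintegralZl// Rintegral_block_sqr//; congr (_ - _).
  have ax : a * x = n.+1%:R^-1 by rewrite /a /node invfM -mulrA mulVf ?mulr1// gt_eqF.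
  by rewrite mulrAC ax mulrC.
have iE : mu.-integrable `]a, b] (EFin \o (fun y => f y / y - a * f a * y `^ (-1 - 1))).
  exact: (integrableB _ ify (integrableZl _ _ i2)).
rewrite E; apply: (le_trans (le_normr_Rintegral _ iE)) => //.
apply: le_Rintegral => //; [exact: integrable_norm iE|exact: (bnd_int _ (ltW a0) n1)|].
move=> y; rewrite /= in_itv/= => yab.
have [_ y0 ay y1 ya] := block_diff x0 n0 n1 yab.
have osc := osc4 x0 n0 n1 yab; rewrite -/a in osc ya ay.
rewrite powRN2 ?(ltW y0)// /bnd powR4_div//.
have -> : f y / y - a * f a * (y * y)^-1 = ((f y - f a) * y + f a * (y - a)) / (y * y).
  by field; rewrite gt_eqF.
have yy0 : 0 < y * y by rewrite mulr_gt0.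
rewrite normrM (ger0_norm (x := _^-1)) ?invr_ge0 ?(ltW yy0)// ler_pdivrMr//.
have -> : (B * q x * (q y / y) + M * x) * (y * y) = B * (q x * q y) * y + M * (x * (y * y)).
  by field; rewrite gt_eqF.
apply: (le_trans (ler_normD _ _)); rewrite !normrM.
rewrite (ger0_norm (ltW y0)) (ger0_norm (x := y - a)) ?subr_ge0//.
apply: lerD; first by rewrite ler_pM2r.
apply: ler_pM => //; first by rewrite subr_ge0.
by rewrite (le_trans ya)// ler_pM2l// ler_pM2l.
Qed.

Definition psum x N : R := \sum_(i < N) f (node x i.+1) / i.+1%:R.

Let blocks4 x m k : 0 < x -> (0 < m)%N -> node x m <= 1 ->
  `|\int[mu]_(y in `]node x (m + k), node x m]) (f y / y) - (psum x (m + k) - psum x m)|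
  <= \int[mu]_(y in `]node x (m + k), node x m]) bnd x y.
Proof.
move=> x0 m0 m1; elim: k => [|k IH].
  by rewrite addn0 set_itvoc0 !Rintegral_set0 !subrr normr0.
have mk0 : (0 < m + k)%N by rewrite addn_gt0 m0.
have L1 := node_le x0 mk0 (leqnSn (m + k)).
have L2 := node_le x0 m0 (leq_addr k m).
have L3 := ltW (node_gt0 x0 (ltn0Sn (m + k))).
rewrite addnS (Rintegral_itv_split L1 L2); last first.
  apply: (integrableS _ _ _ (integrable_div m1)) => //.
  by apply: subset_itvr; rewrite bnd_simp.
rewrite (Rintegral_itv_split (f := bnd x) L1 L2); last exact: bnd_int.
have D1 := block4 x0 mk0 (le_trans L2 m1).
rewrite {1}/psum big_ord_recr/= -/(psum x (m + k)).
apply: le_trans (lerD D1 IH).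
apply: le_trans (ler_normD _ _).
rewrite le_eqVlt; apply/orP; left; apply/eqP; congr `|_|; ring.
Qed.

Definition psi : R := \int[mu]_(y in `]0, 1]) (f y / y).

(** The tail below [node x N] contributes [4 D q (node x N)]. The blocks contribute [4 B q x + M x];
    the interval above the first node and the sum up to that node contribute [M x] each, and
    [x <= q x]. *)
Lemma psum_approx x : 0 < x <= 1 -> exists N0, forall N, (N0 <= N)%N ->
  `|psi - psum x N| <= (4 * B + 3 * M) * q x + 4 * D * q (node x N).
Proof.
move=> /andP[x0 x1].
have [m [mx mx1]] := ex_block x0.
have c0 := node_gt0 x0 (ltn0Sn m); set c := node x m.+1 in c0.
have c1 : c <= 1 by rewrite invf_le1// mulr_gt0.
exists m.+1 => N mN; have [k ->] : exists k, N = (m.+1 + k)%N by exists (N - m.+1)%N; rewrite subnKC.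
have k0 : 0 < node x (m.+1 + k) by exact: node_gt0.
have kc : node x (m.+1 + k) <= c by apply: node_le => //; exact: leq_addr.
have I1 := Rintegral_div_tail (ltW k0) (le_trans kc c1).
have I2 := blocks4 k x0 (ltn0Sn m) c1; rewrite -/c in I2.
have Hb : \int[mu]_(y in `]node x (m.+1 + k), c]) bnd x y <= 4 * B * q x + M * x.
  have ip : mu.-integrable `]node x (m.+1 + k), c] (EFin \o (fun y : R => y `^ (4^-1 - 1))).
    exact: integrable_powR.
  have ic := integrable_itv_cst (node x (m.+1 + k)) c (M * x).
  rewrite RintegralD//; last exact: (integrableZl _ _ ip).
  rewrite RintegralZl// Rintegral_itv_cst//; apply: lerD.
    have := ler_wpM2l (mulr_ge0 B0 (powR_ge0 x 4^-1)) (pow_Rint (ltW k0) kc c1).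
    by move=> /le_trans; apply; lra.
  by apply: ler_piMr; [rewrite mulr_ge0// ltW|lra].
(* The integrand is at most [M / c], and [(1 - c) / c = (m + 1) x - 1] is less than [x]. *)
have I3 : `|\int[mu]_(y in `]c, 1]) (f y / y)| <= M * x.
  apply: (@le_trans _ _ (M * c^-1 * (1 - c))).
    apply: Rintegral_itv_bound => // y /andP[cy _].
    have y0 := lt_trans c0 cy.
    rewrite normrM (ger0_norm (x := _^-1)) ?invr_ge0 ?(ltW y0)// ler_pM ?invr_ge0 ?(ltW y0)//.
    by rewrite lef_pV2 ?posrE// ltW.
  rewrite -mulrA ler_wpM2l// mulrBr mulr1 mulVf ?gt_eqF// nodeV.
  by move: mx; rewrite -natr1; lra.
(* Nodes of index at most [m] lie beyond 1, where [f] vanishes; only the term of index [m + 1]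
   survives, and [1/(m + 1) <= x]. *)
have I4 : `|psum x m.+1| <= M * x.
  rewrite /psum big_ord_recr/= big1 ?add0r; last first.
    move=> [i im] _ /=; rewrite f0 ?mul0r// negb_and -ltNge; apply/orP; right.
    rewrite invf_gt1 ?mulr_gt0//; apply: le_lt_trans mx.
    by rewrite ler_pM2r// ler_nat.
  rewrite normrM ler_pM// ger0_norm// invf_ple ?posrE// -div1r ler_pdivrMr//.
have spl : psi = \int[mu]_(y in `]0, node x (m.+1 + k)]) (f y / y) +
   (\int[mu]_(y in `]node x (m.+1 + k), c]) (f y / y) + \int[mu]_(y in `]c, 1]) (f y / y)).
  rewrite /psi (Rintegral_itv_split (ltW k0) (le_trans kc c1)); last exact: integrable_div.
  congr (_ + _); apply: Rintegral_itv_split => //.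
  apply: (integrableS _ _ _ (integrable_div (lexx 1))) => //.
  by apply: subset_itvr; rewrite bnd_simp ltW.
rewrite spl.
move: I1 I2 I3 I4 Hb.
move: (psum x (m.+1 + k)) (psum x m.+1) => s s'.
move: (Rintegral _ _ _) => i1; move: (Rintegral _ _ _) => i2; move: (Rintegral _ _ _) => i3.
move: (Rintegral _ _ _) => i4.
move=> I1 I2 I3 I4 Hb.
have xq := le_powR4 x0 x1.
have : M * x <= M * q x by rewrite ler_wpM2l.
move: I1 I2 I3 I4; rewrite !ler_norml; lra.
Qed.

End density.

(** * The substitution [y = c / z], and floors as sums of indicators *)

Section inversion.
Context {R : realType}.
Notation mu := (@lebesgue_measure R).

Lemma is_derive1_divl (c z : R) : 0 < z ->
  is_derive z 1 (fun z : R => c / z) (- (c * (z * z)^-1)).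
Proof.
move=> z0; have z00 : z != 0 by rewrite gt_eqF.
have H := is_deriveV z00 (is_derive_id z (1 : R)).
have := is_deriveZ c H.
rewrite /GRing.scale/= mulr1 => {}H; apply: is_derive_eq.
by rewrite mulrN expr2.
Qed.

(** It moves the dependence on [a] and [b] from [c / b] and [c / a] to plain limits of integration,
    so that a primitive evaluated at nodes becomes an integral in [z]. *)
Lemma Rintegral_subst_inv (g : R -> R) (c a b : R) : 0 < c -> 0 < a -> a <= b ->
  (forall x, 0 < x -> {for x, continuous g}) ->
  \int[mu]_(y in `]c / b, c / a]) g y =
  \int[mu]_(z in `]a, b]) (g (c / z) * (c * (z * z)^-1)).
Proof.
move=> c0 a0 ab cg; have b0 : 0 < b by exact: lt_le_trans ab.
pose F (z : R) := c / z.
have dF (z : R) : 0 < z -> derive1 F z = - (c * (z * z)^-1).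
  move=> z0; rewrite derive1E; have [_] := is_derive1_divl c z0; exact.
have cF'' (z : R) : 0 < z -> {for z, continuous (fun z : R => c * (z * z)^-1)}.
  move=> z0; apply: cvgM; first exact: cvg_cst.
  by apply: cvgV; [rewrite mulf_neq0// gt_eqF|exact: cvgM].
have cF' (z : R) : 0 < z -> {for z, continuous (fun z : R => - (c * (z * z)^-1))}.
  by move=> z0; apply: cvgN; exact: cF''.
have cdF (z : R) : 0 < z -> {for z, continuous (derive1 F)}.
  move=> z0; rewrite /prop_for /continuous_at dF//.
  apply: cvg_trans (cF' _ z0); apply: near_eq_cvg; near=> y.
  by rewrite dF//; near: y; exact: lt_nbhsr.
have cF (z : R) : 0 < z -> {for z, continuous F}.
  move=> z0; apply: differentiable_continuous; apply/derivable1_diffP.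
  by have [] := is_derive1_divl c z0.
have cGF (z : R) : 0 < z -> {for z, continuous (fun z => g (F z) * (c * (z * z)^-1))}.
  move=> z0; apply: cvgM.
    apply: (@continuous_comp _ _ _ F g z); first exact: cF.
    by apply: cg; rewrite divr_gt0.
  exact: cF''.
have wc (h : R -> R) (p r : R) : 0 < p -> (forall z, 0 < z -> {for z, continuous h}) ->
    {within `[p, r], continuous h}.
  move=> p0 ch; apply: continuous_in_subspaceT => z; rewrite inE/= in_itv/= => /andP[pz _].
  by apply: ch; exact: lt_le_trans pz.
have cbd : 0 < c / b by rewrite divr_gt0.
have := @integration_by_substitution_decreasing R F g a b ab.
move=> /(_ _ _ _ _ _ _) H.
have mi (h : R -> R) (p r : R) : 0 < p -> (forall z, 0 < z -> {for z, continuous h}) ->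
    measurable_fun `]p, r] (EFin \o h).
  move=> p0 ch; apply/measurable_EFinP.
  apply: (@measurable_funS _ _ (measurableTypeR R) _ [set` `]0, +oo[]) => //.
    by move=> y /=; rewrite !in_itv/= andbT => /andP[py _]; exact: lt_trans py.
  apply: open_continuous_measurable_fun; first exact: interval_open.
  by move=> z; rewrite inE/= in_itv/= andbT => z0; exact: ch.
rewrite /Rintegral integral_itv_obnd_cbnd; last exact: (mi g).
rewrite integral_itv_obnd_cbnd; last exact: mi cGF.
rewrite H.
- congr fine; apply: eq_integral => z; rewrite inE/= in_itv/= => /andP[az _].
  by rewrite fctE/= fctE dF ?opprK//; exact: lt_le_trans az.
- move=> z z'; rewrite !in_itv/= => /andP[az _] /andP[az' _] zz'.
  rewrite /F ltr_pM2l// ltf_pV2 ?posrE//; exact: lt_le_trans a0 _.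
- move=> z; rewrite in_itv/= => /andP[az _]; apply: cdF; exact: lt_trans az.
- by apply/cvg_ex; eexists; apply/cvg_at_right_filter; exact: cdF.
- by apply/cvg_ex; eexists; apply/cvg_at_left_filter; exact: cdF.
- split.
  + move=> z; rewrite in_itv/= => /andP[az _].
    by have [] := is_derive1_divl c (lt_trans a0 az).
  + exact/cvg_at_right_filter/cF.
  + exact/cvg_at_left_filter/cF.
- exact: wc.
Unshelve. all: by end_near. Qed.

End inversion.

(** Used to replace the floor in the kernel by a finite sum of indicators, each of which integrates
    against [f] to a value of its primitive. *)
Lemma sum_indicator_truncn {R : realType} (w : R) N : 0 <= w ->
  \sum_(i < N) (if i.+1%:R <= w then 1 else 0) = (minn N (Num.truncn w))%:R :> R.
Proof.
move=> w0; elim: N => [|N IH]; first by rewrite big_ord0 min0n.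
rewrite big_ord_recr/= IH -truncn_ge_nat//.
case: ifPn => [h|]; last rewrite -ltnNge ltnS => h.
  by rewrite (minn_idPl h) (minn_idPl (ltnW h)) natr1.
by rewrite addr0 (minn_idPr h) (minn_idPr (leq_trans h (leqnSn N))).
Qed.

(** * Representation of [f] as the integral of an explicit density *)

Section representation.
Context {R : realType}.
Notation mu := (@lebesgue_measure R).
Variables (f : R -> R) (M C D lam : R).
Hypothesis mf : measurable_fun [set: R] f.
Hypothesis f0 : forall y, ~~ (0 < y <= 1) -> f y = 0.
Hypothesis fM : forall y, `|f y| <= M.
Hypothesis fC : forall x x', 0 < x <= 1 -> 0 < x' <= 1 ->
  `|f x - f x'| <= C * Num.sqrt `|x^-1 - x'^-1|.
Hypothesis D0 : 0 <= D.
Hypothesis fD : forall x, 0 < x <= 1 -> `|f x| <= D * Num.sqrt x.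
Hypothesis fE : forall x, 0 < x <= 1 ->
  f x = lam * \int[mu]_(y in `]0, 1]) (K x y * f y).
Implicit Types (x y a b : R) (n m N : nat).

Let M0 : 0 <= M. Proof. exact: le_trans (fM 0). Qed.

Let integrable_f a b : mu.-integrable `]a, b] (EFin \o f).
Proof. exact: integrable_itv_bounded. Qed.

Let Phi t := \int[mu]_(y in `]0, t]) f y.

Let Phi_sub s t : 0 <= s -> s <= t -> Phi t - Phi s = \int[mu]_(y in `]s, t]) f y.
Proof. by move=> s0 st; rewrite /Phi (Rintegral_itv_split s0 st)// addrC addKr. Qed.

(** Formally minus the derivative of [Phi (node z n)] with respect to [z]. *)
Let term n z := f (node z n) / n%:R * (z * z)^-1.

Let measurable_node n : measurable_fun [set: R] (fun z : R => node z n).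
Proof. by apply: (measurableT_comp measurable_inv); exact: measurable_funM. Qed.

Let measurable_sqV : measurable_fun [set: R] (fun z : R => (z * z)^-1).
Proof. by apply: (measurableT_comp measurable_inv); exact: measurable_funM. Qed.

Let measurable_term n : measurable_fun [set: R] (term n).
Proof.
apply: measurable_funM => //; apply: measurable_funM => //.
exact: measurableT_comp.
Qed.

Let term_le n a y : (0 < n)%N -> 0 < a -> a < y -> `|term n y| <= M * (a * a)^-1.
Proof.
move=> n0 a0 ay; have y0 := lt_trans a0 ay.
rewrite !normrM; apply: ler_pM => //.
  rewrite -[leRHS]mulr1; apply: ler_pM => //.
  by rewrite ger0_norm// invf_le1 ?ltr0n// ler1n.
rewrite ger0_norm ?invr_ge0 ?mulr_ge0 ?(ltW y0)//.
by rewrite lef_pV2 ?posrE ?mulr_gt0// ler_pM ?(ltW a0) ?(ltW ay).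
Qed.

Let integrable_term n a b : (0 < n)%N -> 0 < a ->
  mu.-integrable `]a, b] (EFin \o term n).
Proof.
move=> n0 a0; apply: (@integrable_itv_bounded _ _ _ _ (M * (a * a)^-1)) => //.
by move=> y /andP[ay _]; exact: term_le.
Qed.

(** All nodes involved lie in []0, 1]], where [f] agrees with its continuous truncation, so the
    substitution applies. *)
Let Phi_node_le n a b : (0 < n)%N -> n%:R^-1 <= a -> a <= b ->
  Phi (node a n) - Phi (node b n) = \int[mu]_(z in `]a, b]) term n z.
Proof.
move=> n0 na ab; have n0' : (0 : R) < n%:R by rewrite ltr0n.
have a0 : 0 < a by apply: lt_le_trans na; rewrite invr_gt0.
have b0 := lt_le_trans a0 ab.
have nE z : node z n = n%:R^-1 / z by rewrite /node invfM.
have le1 (z : R) : a <= z -> node z n <= 1.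
  move=> az; have z0 := lt_le_trans a0 az.
  by rewrite nE ler_pdivrMr// mul1r (le_trans na).
have nz0 (z : R) : 0 < z -> 0 < node z n by move=> z0; rewrite invr_gt0 mulr_gt0.
have nba : node b n <= node a n.
  by rewrite lef_pV2 ?posrE ?mulr_gt0// ler_pM2l.
rewrite Phi_sub ?(ltW (nz0 _ b0))//.
have c0 : (0 : R) < n%:R^-1 by rewrite invr_gt0.
have H := @Rintegral_subst_inv R (fun y : R => f (Num.min y 1)) _ a b c0 a0 ab
  (fun x px => holder_inv_continuous fC px).
transitivity (\int[mu]_(y in `]n%:R^-1 / b, n%:R^-1 / a]) f (Num.min y 1)).
  rewrite -!nE; apply: eq_Rintegral => y; rewrite inE/= in_itv/= => /andP[_ yn].
  by rewrite (min_idPl _)// (le_trans yn)// le1.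
rewrite H; apply: eq_Rintegral => z; rewrite inE/= in_itv/= => /andP[az _].
by rewrite -nE (min_idPl (le1 _ (ltW az))) /term mulrA.
Qed.

Let Phi_node_ge n a b : (0 < n)%N -> 0 < a -> a <= b -> b <= n%:R^-1 ->
  Phi (node a n) - Phi (node b n) = \int[mu]_(z in `]a, b]) term n z.
Proof.
move=> n0 a0 ab bn; have n0' : (0 : R) < n%:R by rewrite ltr0n.
have b0 := lt_le_trans a0 ab.
have nz0 (z : R) : 0 < z -> 0 < node z n by move=> z0; rewrite invr_gt0 mulr_gt0.
have nba : node b n <= node a n.
  by rewrite lef_pV2 ?posrE ?mulr_gt0// ler_pM2l.
have b1 : 1 <= node b n.
  by rewrite invf_ge1 ?mulr_gt0// mulrC -ler_pdivlMr// div1r.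
rewrite Phi_sub ?(ltW (nz0 _ b0))//.
transitivity (0 : R).
  transitivity (\int[mu]_(y in `]node b n, node a n]) (0 : R)).
    apply: eq_Rintegral => y; rewrite inE/= in_itv/= => /andP[by' _].
    by rewrite f0// negb_and -!ltNge (le_lt_trans b1 by') orbT.
  by rewrite Rintegral_itv_cst// mul0r.
(* At [z = b] the node may equal 1, where [f] need not vanish; this null endpoint is dropped
   first. *)
rewrite -Rintegral_itv_bndo_bndc; last first.
  apply: (integrableS _ _ _ (integrable_term b n0 a0)) => //.
  by apply: subset_itvl; rewrite bnd_simp.
transitivity (\int[mu]_(y in `]a, b[) (0 : R)).
  by rewrite Rintegral_cst//= mul0r.
apply: eq_Rintegral => y; rewrite inE/= in_itv/= => /andP[ay yb].
have y0 := lt_trans a0 ay.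
rewrite /term f0 ?mul0r// negb_and -!ltNge; apply/orP; right.
by rewrite invf_gt1 ?mulr_gt0// mulrC -ltr_pdivlMr// div1r (lt_le_trans yb).
Qed.

Let Phi_node n a b : (0 < n)%N -> 0 < a -> a <= b ->
  Phi (node a n) - Phi (node b n) = \int[mu]_(z in `]a, b]) term n z.
Proof.
move=> n0 a0 ab.
have [na|an] := leP n%:R^-1 a; first exact: Phi_node_le.
have [bn|nb] := leP b n%:R^-1; first exact: Phi_node_ge.
rewrite (Rintegral_itv_split (ltW an) (ltW nb)); last exact: integrable_term.
rewrite -Phi_node_ge ?(ltW an)// -Phi_node_le ?(ltW nb)//.
by rewrite addrA subrK.
Qed.

Definition approx N x : R :=
  lam * (2^-1 * Phi 1 - psi f / x + \sum_(i < N) Phi (node x i.+1)).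

(** The integrand [K x y * f y] with the floor cut off at [N]. *)
Let hN x N y := (2^-1 - (x * y)^-1 +
   \sum_(i < N) (if i.+1%:R <= (x * y)^-1 then 1 else 0)) * f y.

Let indE x n y : 0 < x -> 0 < y -> (n.+1%:R <= (x * y)^-1) = (y <= node x n.+1).
Proof.
move=> x0 y0; rewrite /node -[(x * y)^-1]mul1r -[(_ * x)^-1]mul1r.
rewrite !ler_pdivlMr ?mulr_gt0//; congr (_ <= _); ring.
Qed.

Let integrable_div1 : mu.-integrable `]0, 1] (EFin \o (fun y => f y / y)).
Proof. by apply: integrable_div fD _ _ => //. Qed.

(** The indicator cuts []0, 1]] down to [y <= node x n.+1]; if that node exceeds 1 the value is
    unchanged because [f] vanishes beyond 1. *)
Let ind_int x n : 0 < x ->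
  mu.-integrable `]0, 1] (EFin \o (fun y => (if n.+1%:R <= (x * y)^-1 then 1 else 0) * f y)) /\
  \int[mu]_(y in `]0, 1]) ((if n.+1%:R <= (x * y)^-1 then 1 else 0) * f y) =
  Phi (node x n.+1).
Proof.
move=> x0.
have E : (fun y => (if n.+1%:R <= (x * y)^-1 then 1 else 0) * f y) \_ `]0, 1] =
    f \_ `]0, node x n.+1].
  apply/funext => y; rewrite !patchE.
  have [y0|y0] := ltP 0 y; last first.
    by rewrite !memNset//= in_itv/= ltNge y0.
  rewrite indE//; have [y1|y1] := leP y 1.
    rewrite mem_set/= ?in_itv/= ?y0//.
    case: ifPn => h; first by rewrite mem_set ?mul1r//= in_itv/= y0.
    by rewrite memNset ?mul0r//= in_itv/= y0; exact/negP.
  rewrite memNset/= ?in_itv/= ?y0 ?(lt_geF y1)//.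
  by case: ifPn => //; rewrite f0// negb_and -!ltNge y1 orbT.
split; last by rewrite /Phi Rintegral_mkcond [in RHS]Rintegral_mkcond E.
rewrite integrable_mkcond// restrict_EFin E -restrict_EFin -integrable_mkcond//.
Qed.

Let hN_int x N : 0 < x ->
  mu.-integrable `]0, 1] (EFin \o hN x N) /\
  \int[mu]_(y in `]0, 1]) hN x N y =
  2^-1 * Phi 1 - psi f / x + \sum_(i < N) Phi (node x i.+1).
Proof.
move=> x0; elim: N => [|N [IH1 IH2]].
  have E y : hN x 0 y = 2^-1 * f y - x^-1 * (f y / y).
    by rewrite /hN big_ord0 addr0 mulrBl invfM -mulrA (mulrC y^-1).
  have i1 : mu.-integrable `]0, 1] (EFin \o (fun y => 2^-1 * f y)).
    exact: (integrableZl _ _ (integrable_f 0 1)).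
  have i2 : mu.-integrable `]0, 1] (EFin \o (fun y => x^-1 * (f y / y))).
    exact: (integrableZl _ _ integrable_div1).
  have -> : hN x 0 = (fun y => 2^-1 * f y - x^-1 * (f y / y)) by apply/funext.
  split; first exact: (integrableB _ i1 i2).
  rewrite RintegralB// !RintegralZl// big_ord0 addr0.
  by rewrite /psi -/(Phi 1) (mulrC x^-1).
have [j1 j2] := ind_int N x0.
have -> : hN x N.+1 = (fun y => hN x N y + (if N.+1%:R <= (x * y)^-1 then 1 else 0) * f y).
  by apply/funext => y; rewrite /hN big_ord_recr/= addrA mulrDl.
split; first exact: (integrableD _ IH1 j1).
by rewrite RintegralD// IH2 j2 big_ord_recr/= addrA.
Qed.

(** Dominated convergence: for each [y] the cut-off floor is eventually the floor itself, and it
    never exceeds [1/(x y)]. The majorant is integrable because [f(y) / y] is, which rests on the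
    decay of [f]. *)
Lemma approx_cvg x : 0 < x <= 1 -> approx N x @[N --> \oo] --> f x.
Proof.
move=> /andP[x0 x1]; rewrite fE ?x0// /approx.
apply: cvgM; first exact: cvg_cst.
under eq_fun do rewrite -(hN_int _ x0).2.
have iG : mu.-integrable `]0, 1] (EFin \o (fun y => M + 2 / x * `|f y / y|)).
  apply: (integrableD _ (integrable_itv_cst 0 1 M) (integrableZl _ _ (integrable_norm integrable_div1))) => //.
have cntE y N : 0 < y -> hN x N y =
    (2^-1 - (x * y)^-1 + (minn N (Num.truncn (x * y)^-1))%:R) * f y.
  by move=> y0; rewrite /hN sum_indicator_truncn// invr_ge0 mulr_ge0 ?ltW.
have := @dominated_convergence _ _ _ mu `]0, 1] _ (fun N => EFin \o hN x N)
  (EFin \o (fun y => K x y * f y)) (EFin \o (fun y => M + 2 / x * `|f y / y|)).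
move=> /(_ _ _ _ _ iG _)[].
- by [].
- by move=> N; exact: measurable_int (hN_int N x0).1.
- apply/measurable_EFinP/measurable_funTS; apply: measurable_funM => //.
  exact: measurable_K.
- apply: aeW => y; rewrite /= in_itv/= => /andP[y0 y1].
  apply: cvg_EFin; first by apply: nearW.
  apply: (@cvg_near_cst _ _ _ _ _).
  exists (Num.truncn (x * y)^-1) => // N /= hNt.
  rewrite /= cntE// (minn_idPr hNt) KE//; congr ((_ + _) * _).
  have w0 : 0 <= (x * y)^-1 by rewrite invr_ge0 mulr_ge0 ?ltW.
  by rewrite truncn_floor w0 natr_absz ger0_norm// floor_ge0.
- apply: aeW => y N; rewrite /= in_itv/= => /andP[y0 y1].
  rewrite lee_fin cntE// normrM.
  have w0 : 0 <= (x * y)^-1 by rewrite invr_ge0 mulr_ge0 ?ltW.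
  have -> : 2 / x * `|f y / y| = 2 * (x * y)^-1 * `|f y|.
    rewrite normrM (ger0_norm (x := y^-1)) ?invr_ge0 ?(ltW y0)// invfM.
    by rewrite !mulrA; ring.
  apply: (@le_trans _ _ ((1 + 2 * (x * y)^-1) * `|f y|)); last first.
    by rewrite mulrDl mul1r lerD2r.
  rewrite ler_wpM2r//.
  have : ((minn N (Num.truncn (x * y)^-1))%:R : R) <= (x * y)^-1.
    apply: (@le_trans _ _ (Num.truncn (x * y)^-1)%:R); first by rewrite ler_nat geq_minr.
    by rewrite truncn_le.
  have : (0 : R) <= (minn N (Num.truncn (x * y)^-1))%:R by [].
  move: (minn N (Num.truncn (x * y)^-1))%:R => p.
  by move: (x * y)^-1 w0 => w w0 h1 h2; rewrite ler_norml; lra.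
move=> iK _ H; apply: fine_cvg; rewrite fineK; first exact: H.
exact: (integrable_fin_num _ iK).
Qed.

(** The formal derivative of [approx N]. *)
Let dens N z := lam * (z * z)^-1 * (psi f - psum f z N).

Let densS N z : dens N.+1 z = dens N z - lam * term N.+1 z.
Proof.
rewrite /dens /psum big_ord_recr/= /term.
by move: (\sum_(i < N) _) (_ / N.+1%:R) => s t; ring.
Qed.

Let dens_int N a b : 0 < a -> a <= b ->
  mu.-integrable `]a, b] (EFin \o dens N) /\
  approx N b - approx N a = \int[mu]_(z in `]a, b]) dens N z.
Proof.
move=> a0 ab; have b0 := lt_le_trans a0 ab.
elim: N => [|N [IH1 IH2]].
  have i2 := integrable_powR (-1 - 1) b a0.
  have E z : a < z -> dens 0 z = lam * psi f * z `^ (-1 - 1).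
    move=> az; rewrite powRN2 ?(ltW (lt_trans a0 az))//.
    by rewrite /dens /psum big_ord0 subr0 mulrAC.
  have i3 : mu.-integrable `]a, b] (EFin \o (fun z => lam * psi f * z `^ (-1 - 1))).
    exact: (integrableZl _ _ i2).
  split.
    apply: (eq_integrable _ _ _ _ i3) => // z; rewrite inE/= in_itv/= => /andP[az _].
    by rewrite E.
  transitivity (\int[mu]_(z in `]a, b]) (lam * psi f * z `^ (-1 - 1))); last first.
    by apply: eq_Rintegral => z; rewrite inE/= in_itv/= => /andP[az _]; rewrite E.
  rewrite RintegralZl// Rintegral_powR// !powR_inv1 ?(ltW a0) ?(ltW b0)//.
  by rewrite /approx !big_ord0 !addr0 invrN1; ring.
have i4 : mu.-integrable `]a, b] (EFin \o (fun z => lam * term N.+1 z)).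
  by apply: (integrableZl _ _ (integrable_term b _ a0)).
have -> : dens N.+1 = (fun z => dens N z - lam * term N.+1 z).
  by apply/funext => z; exact: densS.
split; first exact: (integrableB _ IH1 i4).
rewrite RintegralB// -IH2 RintegralZl//; last exact: integrable_term.
rewrite -Phi_node// /approx !big_ord_recr/=.
by move: (\sum_(i < N) _) (\sum_(i < N) _) => s t; ring.
Qed.

(** Telescoping: [n^(-3/2)] is at most [2 / sqrt (n-1) - 2 / sqrt n] for [n >= 2]. *)
Lemma sum_inv_sqrt3 N :
  \sum_(i < N.+1) (Num.sqrt i.+1%:R * i.+1%:R)^-1 <= 3 - 2 / Num.sqrt N.+1%:R :> R.
Proof.
elim: N => [|N IH].
  by rewrite big_ord_recr big_ord0/= sqrtr1 mulr1 invr1; lra.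
rewrite big_ord_recr/=; apply: (le_trans (lerD IH (lexx _))).
set s := Num.sqrt N.+1%:R; set t := Num.sqrt N.+2%:R.
have s0 : 0 < s by rewrite sqrtr_gt0 ltr0n.
have t0 : 0 < t by rewrite sqrtr_gt0 ltr0n.
have ss : s * s = N.+1%:R by rewrite -expr2 sqr_sqrtr.
have tt : t * t = N.+2%:R by rewrite -expr2 sqr_sqrtr.
have st : s <= t by rewrite ler_sqrt// ler_nat.
have ts : t * t - s * s = 1 by rewrite ss tt -(natr1 N.+1); ring.
rewrite -tt.
have -> : 3 - 2 / s + (t * (t * t))^-1 = 3 - 2 / t - ((2 / s - 2 / t) - (t * (t * t))^-1).
  by ring.
rewrite gerBl subr_ge0.
have -> : 2 / s - 2 / t = 2 / (s * t * (s + t)).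
  have -> : 2 / s - 2 / t = 2 * (t * t - s * s) / (s * t * (s + t)).
    by field; rewrite !gt_eqF// addr_gt0.
  by rewrite ts mulr1.
rewrite -[leLHS]mul1r ler_pdivrMr ?mulr_gt0// mulrAC ler_pdivlMr ?mulr_gt0 ?addr_gt0//.
rewrite mul1r.
have : s * t * (s + t) <= t * t * (t + t).
  by apply: ler_pM; rewrite ?mulr_ge0 ?addr_ge0 ?(ltW s0) ?(ltW t0)// ?ler_pM2r ?lerD2r.
lra.
Qed.

(** Decay at the nodes turns the harmonic weights into [n^(-3/2)], whence absolute convergence,
    uniform for [x] away from 0. *)
Let psum_term_le x i : 0 < x ->
  `|f (node x i.+1) / i.+1%:R| <= D / Num.sqrt x * (Num.sqrt i.+1%:R * i.+1%:R)^-1.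
Proof.
move=> x0; have n0 := node_gt0 x0 (ltn0Sn i).
have sx0 : 0 < Num.sqrt x by rewrite sqrtr_gt0.
have sn0 : 0 < Num.sqrt (i.+1%:R : R) by rewrite sqrtr_gt0 ltr0n.
have i0 : (0 : R) < i.+1%:R by rewrite ltr0n.
have [n1|n1] := leP (node x i.+1) 1; last first.
  rewrite f0 ?mul0r ?normr0; last by rewrite negb_and -!ltNge n1 orbT.
  by rewrite mulr_ge0 ?divr_ge0 ?invr_ge0 ?mulr_ge0 ?(ltW sx0) ?(ltW sn0).
rewrite normrM (ger0_norm (x := _^-1))// invfM mulrA ler_pM2r ?invr_gt0//.
apply: (le_trans (fD _)); first by rewrite n0.
rewrite -mulrA ler_wpM2l// -invfM /node sqrtrV; last by rewrite mulr_ge0 ?(ltW x0).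
by rewrite sqrtrM// mulrC.
Qed.

Let psum_norm x N : 0 < x ->
  \sum_(i < N) `|f (node x i.+1) / i.+1%:R| <= 3 * D / Num.sqrt x.
Proof.
move=> x0; have sx0 : 0 < Num.sqrt x by rewrite sqrtr_gt0.
apply: (@le_trans _ _ (\sum_(i < N.+1) D / Num.sqrt x * (Num.sqrt i.+1%:R * i.+1%:R)^-1)).
  rewrite big_ord_recr/= -[leLHS]addr0; apply: lerD.
    by apply: ler_sum => i _; exact: psum_term_le.
  by rewrite mulr_ge0 ?divr_ge0 ?invr_ge0 ?mulr_ge0 ?sqrtr_ge0.
rewrite -mulr_sumr.
have Ds : 0 <= D / Num.sqrt x by rewrite divr_ge0// sqrtr_ge0.
apply: (le_trans (ler_wpM2l Ds (sum_inv_sqrt3 N))).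
rewrite -mulrA [leRHS]mulrC ler_wpM2l// gerBl divr_ge0// sqrtr_ge0.
Qed.

Let psum_cvg x : 0 < x -> cvgn (psum f x).
Proof.
move=> x0.
have E (u : nat -> R) : (fun N => \sum_(i < N) u i) = series u.
  by apply/funext => N; rewrite /series/= big_mkord.
rewrite /psum (E (fun i => f (node x i.+1) / i.+1%:R)).
apply: normed_cvg.
have := E (fun i => `|f (node x i.+1) / i.+1%:R|) => En.
suff : cvgn (fun N => \sum_(i < N) `|f (node x i.+1) / i.+1%:R|) by rewrite En.
apply: nondecreasing_is_cvgn.
  apply/nondecreasing_seqP => N; rewrite big_ord_recr/=.
  by rewrite lerDl.
exists (3 * D / Num.sqrt x) => _ [N _ <-]; exact: psum_norm.
Qed.

Let S z := lam * (z * z)^-1 * (psi f - limn (psum f z)).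

Let dens_cvg z : 0 < z -> dens N z @[N --> \oo] --> S z.
Proof.
move=> z0; apply: cvgM; first exact: cvg_cst.
by apply: cvgB; [exact: cvg_cst|exact: psum_cvg].
Qed.

Definition density : R -> R := S \_ `]0, 1].

Lemma measurable_density : measurable_fun [set: R] density.
Proof.
apply/(measurable_restrictT _ _).1 => //.
apply: (measurable_fun_cvg (h := dens)) => [N|z]; last first.
  by rewrite /= in_itv/= => /andP[z0 _]; exact: dens_cvg.
apply: measurable_funTS; apply: measurable_funM; first exact: measurable_funM.
apply: measurable_funB => //; apply: measurable_sum => i.
by apply: measurable_funM => //; exact: measurableT_comp.
Qed.

(** The identity for [approx N] and [dens N] passes to the limit on both sides. *)
Lemma density_repr a b : 0 < a -> a <= b -> b <= 1 ->
  f b - f a = \int[mu]_(z in `]a, b]) density z.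
Proof.
move=> a0 ab b1; have b0 := lt_le_trans a0 ab.
transitivity (\int[mu]_(z in `]a, b]) S z); last first.
  apply: eq_Rintegral => z; rewrite inE/= in_itv/= => /andP[az zb].
  by rewrite /density patchE mem_set//= in_itv/= (lt_trans a0 az) (le_trans zb).
have Ha : approx N a @[N --> \oo] --> f a by apply: approx_cvg; rewrite a0 (le_trans ab).
have Hb : approx N b @[N --> \oo] --> f b by apply: approx_cvg; rewrite b0.
have H := cvgB Hb Ha.
have {}H : \int[mu]_(z in `]a, b]) dens N z @[N --> \oo] --> f b - f a.
  have -> : (fun N => \int[mu]_(z in `]a, b]) dens N z) = (fun N => approx N b - approx N a).
    by apply/funext => N; rewrite (dens_int N a0 ab).2.
  exact: H.
suff H' : \int[mu]_(z in `]a, b]) dens N z @[N --> \oo] --> \int[mu]_(z in `]a, b]) S z.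
  by rewrite -(cvg_lim _ H)// -(cvg_lim _ H').
(* The factor [1/z^2] and the bound [3 D / sqrt z] on the partial sums are both largest at the left
   end [a]. *)
pose G := `|lam| * (a * a)^-1 * (`|psi f| + 3 * D / Num.sqrt a).
have := @dominated_convergence _ _ _ mu `]a, b] _ (fun N => EFin \o dens N)
  (EFin \o S) (EFin \o (fun _ => G)).
move=> /(_ _ _ _ _ (integrable_itv_cst a b G) _)[].
- by [].
- by move=> N; exact: measurable_int (dens_int N a0 ab).1.
- apply/measurable_EFinP.
  apply: (measurable_fun_cvg (h := dens)) => [N|z]; last first.
    by rewrite /= in_itv/= => /andP[az _]; apply: dens_cvg; exact: lt_trans az.
  by apply/measurable_EFinP; exact: measurable_int (dens_int N a0 ab).1.
- apply: aeW => z; rewrite /= in_itv/= => /andP[az _].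
  apply: cvg_EFin; first exact: nearW.
  by apply: dens_cvg; exact: lt_trans az.
- apply: aeW => z N; rewrite /= in_itv/= => /andP[az _]; rewrite lee_fin.
  have z0 := lt_trans a0 az.
  rewrite /dens /G !normrM; apply: ler_pM => //.
    rewrite ler_wpM2l// ger0_norm ?invr_ge0 ?mulr_ge0 ?(ltW z0)//.
    by rewrite lef_pV2 ?posrE ?mulr_gt0// ler_pM ?(ltW a0) ?(ltW az).
  apply: (le_trans (ler_normB _ _)); rewrite lerD2l.
  apply: (le_trans (ler_norm_sum _ _ _)); apply: (le_trans (psum_norm N z0)).
  rewrite ler_wpM2l ?mulr_ge0// lef_pV2 ?posrE ?sqrtr_gt0//.
  by rewrite ler_sqrt// ltW.
move=> iS _ HS; apply: fine_cvg; rewrite fineK; first exact: HS.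
exact: (integrable_fin_num _ iS).
Qed.

Definition density_cst := `|lam| * (4 * (C + 2 * D) + 3 * M).

Lemma density_cst_ge0 : 0 <= density_cst.
Proof.
have C0 := holder_cst_ge0 fC.
by rewrite !mulr_ge0// !addr_ge0// !mulr_ge0// addr_ge0// mulr_ge0.
Qed.

(** The quadrature estimate with [N] tending to infinity, so that its term in [node z N]
    disappears. *)
Lemma density_bound z : 0 < z <= 1 ->
  `|density z| <= density_cst * (z `^ 4^-1 / (z * z)).
Proof.
move=> /andP[z0 z1].
rewrite /density patchE mem_set/= ?in_itv/= ?z0// /S !normrM.
rewrite (ger0_norm (x := _^-1)) ?invr_ge0 ?mulr_ge0 ?(ltW z0)//.
rewrite /density_cst -[leLHS]mulrA -[leRHS]mulrA ler_wpM2l//.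
rewrite mulrA [leRHS]mulrC ler_wpM2l ?invr_ge0 ?mulr_ge0 ?(ltW z0)//.
have cv : `|psi f - psum f z N| @[N --> \oo] --> `|psi f - limn (psum f z)|.
  by apply: cvg_norm; apply: cvgB; [exact: cvg_cst|exact: psum_cvg].
apply/ler_addgt0Pr => e e0; rewrite -(cvg_lim _ cv)//.
apply: limr_le; first by apply/cvg_ex; eexists; exact: cv.
have [|N0 HN0] := psum_approx mf f0 fM fC D0 fD (x := z); first by rewrite z0.
(* Once the node is below the fourth power of this number, the tail term is at most [e]; the [+ 1]
   covers [D = 0]. *)
have d0 : 0 < e / (4 * D + 1) by rewrite divr_gt0// ltr_wpDl// mulr_ge0.
have [N1 _ HN1] := node_small z0 (exprn_gt0 4 d0).
exists (maxn N0 N1) => // N /=; rewrite geq_max => /andP[h0 h1].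
apply: (le_trans (HN0 _ h0)); rewrite lerD2l.
have : node z N `^ 4^-1 <= e / (4 * D + 1).
  apply: (@le_trans _ _ (((e / (4 * D + 1)) ^+ 4) `^ 4^-1)).
    apply: powR4_le; last exact: HN1.
    by rewrite invr_ge0 mulr_ge0 ?(ltW z0).
  by rewrite -powR_mulrn ?(ltW d0)// -powRrM divff// powRr1// ltW.
move=> /(ler_wpM2l (_ : 0 <= 4 * D)) hh; apply: (le_trans (hh _)); first by rewrite mulr_ge0.
rewrite mulrA ler_pdivrMr ?ltr_wpDl ?mulr_ge0//.
by have := D0; nra.
Qed.

End representation.

(** * Difference quotients, and differentiability almost everywhere *)

Section derivative_ae.
Context {R : realType}.
Notation mu := (@lebesgue_measure R).

(* Only the left difference quotients are used: [K x] is left continuous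
   at 1, whereas it jumps on the right when [1/x] is an integer. *)
Definition tseq (n : nat) : R := 1 - n.+2%:R^-1.

Lemma tseq_itv n : 2^-1 <= tseq n < 1.
Proof.
rewrite /tseq; apply/andP; split.
  have : n.+2%:R^-1 <= 2^-1 :> R by rewrite lef_pV2 ?posrE ?ltr0n// ler_nat.
  by move: n.+2%:R^-1 => u; lra.
by rewrite ltrBlDr ltrDl invr_gt0.
Qed.

Lemma tseq_cvg : tseq n @[n --> \oo] --> (1 : R).
Proof.
rewrite -[X in _ --> X]subr0; apply: cvgB; first exact: cvg_cst.
have := @cvg_harmonic R.
by rewrite -(cvg_shiftS (fun n : nat => n.+1%:R^-1 : R)).
Qed.

(** The points [tseq n * x] stay in []0, 1]] and differ from [x], so they are admissible at the
    endpoint 1 as well. *)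
Lemma has_deriv01_seq (phi : R -> R) (x d : R) : 0 < x <= 1 -> has_deriv01 phi x d ->
  (phi (tseq n * x) - phi x) / (tseq n * x - x) @[n --> \oo] --> d.
Proof.
move=> /andP[x0 x1] H.
have hc : tseq n * x - x @[n --> \oo] --> (0 : R).
  rewrite (_ : 0 = 1 * x - x); last by rewrite mul1r subrr.
  apply: cvgB; last exact: cvg_cst.
  by apply: cvgM; [exact: tseq_cvg|exact: cvg_cst].
have : (fun h : R => (phi (x + h) - phi x) / h) (tseq n * x - x) @[n --> \oo] --> d.
  move=> B /H /hc[N _ HN]; exists N => // n /= Nn; apply: (HN n Nn).
  have /andP[t1 t2] := tseq_itv n.
  rewrite /= [x + _]addrC subrK; split.
    by rewrite lt_eqF// subr_lt0 gtr_pMl.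
  rewrite mulr_ge0 ?(ltW x0)//=; last by lra.
  by apply: (le_trans _ x1); rewrite ger_pMl// ltW.
by under eq_fun do rewrite [x + _]addrC subrK.
Qed.

(** Serves to identify the value selected by [xget] in [deriv01]. *)
Lemma has_deriv01_unique (phi : R -> R) (x d d' : R) : 0 < x <= 1 ->
  has_deriv01 phi x d -> has_deriv01 phi x d' -> d = d'.
Proof.
move=> x01 /(has_deriv01_seq x01) H /(has_deriv01_seq x01) H'.
by rewrite -(cvg_lim _ H)// -(cvg_lim _ H').
Qed.

Lemma deriv01E (phi : R -> R) (x d : R) : 0 < x <= 1 ->
  has_deriv01 phi x d -> deriv01 phi x = d.
Proof.
move=> x01 H; apply: (has_deriv01_unique x01 _ H).
by rewrite /deriv01; case: xgetP => [y -> //|/(_ d)].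
Qed.

Variables (f S : R -> R) (A : R).
Hypothesis mS : measurable_fun [set: R] S.
Hypothesis A0 : 0 <= A.
Hypothesis SA : forall z, 0 < z <= 1 -> `|S z| <= A * (z `^ 4^-1 / (z * z)).
Hypothesis fS : forall a b, 0 < a -> a <= b -> b <= 1 ->
  f b - f a = \int[mu]_(z in `]a, b]) S z.

Lemma powR4_div2_le (v z : R) : 0 < v -> v <= z ->
  z `^ 4^-1 / (z * z) <= v `^ 4^-1 / (v * v).
Proof.
move=> v0 vz; have z0 := lt_le_trans v0 vz.
have zv : 1 <= z / v by rewrite ler_pdivlMr// mul1r.
have E : z `^ 4^-1 = v `^ 4^-1 * (z / v) `^ 4^-1.
  by rewrite -powRM ?divr_ge0 ?(ltW v0) ?(ltW z0)// mulrCA divff ?mulr1// gt_eqF.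
have h : (z / v) `^ 4^-1 <= z / v by apply: ler1_powR => //; lra.
rewrite E ler_pdivrMr ?mulr_gt0//.
apply: (@le_trans _ _ (v `^ 4^-1 * (z / v))).
  by rewrite ler_wpM2l// powR_ge0.
rewrite -[leRHS]mulrA ler_wpM2l ?powR_ge0//.
have -> : (v * v)^-1 * (z * z) = (z / v) * (z / v) by field; rewrite gt_eqF.
by rewrite ler_peMl// (le_trans _ zv).
Qed.

Lemma increment_le (v w : R) : 0 < v -> v <= w -> w <= 1 ->
  `|f w - f v| <= A * (v `^ 4^-1 / (v * v)) * (w - v).
Proof.
move=> v0 vw w1; rewrite fS//; apply: Rintegral_itv_bound => // z /andP[vz zw].
apply: (le_trans (SA _)); first by rewrite (lt_trans v0 vz) (le_trans zw).
by rewrite ler_wpM2l// powR4_div2_le// ltW.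
Qed.

(** The bound [A z^(-7/4)] is not integrable at 0, so [S] is first cut off to []a, 1]], where it is
    bounded; the Lebesgue differentiation theorem then applies. *)
Let deriv_ae_gt (a : R) : 0 < a ->
  {ae mu, forall x : R, a < x < 1 -> is_derive x 1 f (S x)}.
Proof.
move=> a0; pose Sa := S \_ `]a, 1].
have mSa : measurable_fun [set: R] Sa.
  by apply/(measurable_restrictT _ _).1 => //; exact: measurable_funTS.
have SaM z : `|Sa z| <= A * (a `^ 4^-1 / (a * a)).
  rewrite /Sa patchE; case: ifPn => [|_]; last first.
    by rewrite normr0 mulr_ge0// divr_ge0 ?powR_ge0// mulr_ge0 ?(ltW a0).
  rewrite inE/= in_itv/= => /andP[az z1]; apply: (le_trans (SA _)).
    by rewrite (lt_trans a0 az).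
  by rewrite ler_wpM2l// powR4_div2_le// ltW.
have iSa (y : R) : mu.-integrable [set` Interval (BRight a) (BRight y)] (EFin \o Sa).
  by apply: integrable_itv_bounded.
have lSa : locally_integrable [set: R] Sa.
  split => //; first exact: openT.
  move=> B _ cB; have mB := compact_measurable cB.
  have := @measurable_bounded_integrable _ _ _ mu Sa B mB.
  move=> /(_ _ _ _)/integrableP[]//.
  - exact: compact_finite_measure.
  - exact: measurable_funTS.
  - exists (A * (a `^ 4^-1 / (a * a))); split; first exact: num_real.
    by move=> c cM y _ /=; rewrite (le_trans (SaM y))// ltW.
have := FTC1 iSa lSa; apply: filterS; first exact: (ae_filter_ringOfSetsType mu).
move=> x /= H /andP[ax x1].
have [|dF F'] := H; first by rewrite lte_fin.
have SE : S x = Sa x by rewrite /Sa patchE mem_set//= in_itv/= ax ltW.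
(* Near an interior point, [f] is the constant [f a] plus the primitive of the cut-off density. *)
have nearE : \forall y \near x, f a + \int[mu]_(t in `]a, y]) Sa t = f y.
  near=> y.
  have ay : a < y by near: y; exact: lt_nbhsr.
  have y1 : y < 1 by near: y; exact: lt_nbhsl.
  have := fS a0 (ltW ay) (ltW y1).
  rewrite (_ : \int[mu]_(z in `]a, y]) S z = \int[mu]_(z in `]a, y]) Sa z).
    by move=> <-; rewrite addrC subrK.
  apply: eq_Rintegral => z; rewrite inE/= in_itv/= => /andP[az zy].
  by rewrite /Sa patchE mem_set//= in_itv/= az (le_trans zy) ?ltW.
rewrite SE -F' derive1E.
apply: (@near_eq_is_derive _ _ _ (fun y => f a + \int[mu]_(t in `]a, y]) Sa t)).
- exact: nearE.
- rewrite -[X in is_derive _ _ _ X]add0r.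
  apply: (is_deriveD (is_derive_cst (f a) x 1)).
  by split; [exact: dF|].
Unshelve. all: by end_near. Qed.

Lemma deriv_ae : {ae mu, forall x : R, 0 < x < 1 -> is_derive x 1 f (S x)}.
Proof.
have : {ae mu, forall (x : R) (n : nat), n.+1%:R^-1 < x < 1 -> is_derive x 1 f (S x)}.
  apply: ae_foralln => n; exact: deriv_ae_gt.
apply: filterS; first exact: (ae_filter_ringOfSetsType mu).
move=> x H /andP[x0 x1].
apply: (H (Num.truncn x^-1)); rewrite x1 andbT.
by rewrite -[ltRHS]invrK ltf_pV2 ?posrE ?invr_gt0// truncnS_gt.
Qed.

End derivative_ae.

(** * The dilated eigenvalue equation and its limit as [t] tends to 1 *)

Section dilation_identity.
Context {R : realType}.
Notation mu := (@lebesgue_measure R).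
Variables (f S : R -> R) (M C A lam : R).
Hypothesis mf : measurable_fun [set: R] f.
Hypothesis f0 : forall y, ~~ (0 < y <= 1) -> f y = 0.
Hypothesis fM : forall y, `|f y| <= M.
Hypothesis fC : forall x x', 0 < x <= 1 -> 0 < x' <= 1 ->
  `|f x - f x'| <= C * Num.sqrt `|x^-1 - x'^-1|.
Hypothesis fE : forall x, 0 < x <= 1 ->
  f x = lam * \int[mu]_(y in `]0, 1]) (K x y * f y).
Hypothesis mS : measurable_fun [set: R] S.
Hypothesis A0 : 0 <= A.
Hypothesis SA : forall z, 0 < z <= 1 -> `|S z| <= A * (z `^ 4^-1 / (z * z)).
Hypothesis fS : forall a b, 0 < a -> a <= b -> b <= 1 ->
  f b - f a = \int[mu]_(z in `]a, b]) S z.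

Let M0 : 0 <= M. Proof. exact: le_trans (fM 0). Qed.

Let mKf x : measurable_fun [set: R] (fun y => K x y * f y).
Proof. by apply: measurable_funM => //; exact: measurable_K. Qed.

Let Kf_le x y : `|K x y * f y| <= M.
Proof.
rewrite normrM -[leRHS]mul1r; apply: ler_pM => //.
by apply: (le_trans (K_le _ _)); lra.
Qed.

Let mfscale t : measurable_fun [set: R] (fun v => f (v / t)).
Proof. by apply: measurableT_comp => //; exact: measurable_funM. Qed.

Lemma restrict_supp (g : R -> R) : (forall y, ~~ (0 < y <= 1) -> g y = 0) ->
  g \_ `]0, 1] = g.
Proof.
move=> g0; apply/funext => y; rewrite patchE; case: ifPn => //.
by rewrite notin_setE/= in_itv/= => /negP /g0.
Qed.

(** Substitute [y = v / t] in the equation at [t x]; the factor [t] is the Jacobian. The dilated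
    function is supported in []0, t]], hence still in []0, 1]]. *)
Let dilation t x : 0 < t < 1 -> 0 < x <= 1 ->
  t * f (t * x) - f x = lam * \int[mu]_(v in `]0, 1]) (K x v * (f (v / t) - f v)).
Proof.
move=> /andP[t0 t1] /andP[x0 x1].
have G0 (z : R) : forall y, ~~ (0 < y <= 1) -> K z y * f y = 0.
  by move=> y /f0 ->; rewrite mulr0.
have iG z : mu.-integrable setT (EFin \o (fun y => K z y * f y)).
  rewrite -(restrict_supp (G0 z)) -restrict_EFin -integrable_mkcond//.
  exact: integrable_itv_bounded.
have fv0 y : ~~ (0 < y <= 1) -> f (y / t) = 0.
  move=> y01; apply: f0; apply: contra y01 => /andP[].
  rewrite pmulr_lgt0 ?invr_gt0// => -> /=; rewrite ler_pdivrMr// mul1r => /le_trans; apply.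
  exact: ltW.
have i1 : mu.-integrable `]0, 1] (EFin \o (fun v => K x v * f (v / t))).
  apply: (@integrable_itv_bounded _ _ _ _ M); first by apply: measurable_funM => //; exact: measurable_K.
  move=> y _; rewrite normrM -[leRHS]mul1r; apply: ler_pM => //.
  by apply: (le_trans (K_le _ _)); lra.
have i2 : mu.-integrable `]0, 1] (EFin \o (fun v => K x v * f v)).
  exact: integrable_itv_bounded.
have -> : \int[mu]_(v in `]0, 1]) (K x v * (f (v / t) - f v)) =
   \int[mu]_(v in `]0, 1]) (K x v * f (v / t)) - \int[mu]_(v in `]0, 1]) (K x v * f v).
  by rewrite -RintegralB//; apply: eq_Rintegral => v _; rewrite mulrBr.
rewrite mulrBr -(fE (x := x)) ?x0//; congr (_ - _).
rewrite fE; last by rewrite mulr_gt0// (le_trans _ x1)// ger_pMl// ltW.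
rewrite mulrCA; congr (_ * _).
rewrite Rintegral_mkcond (restrict_supp (G0 _)) -Rintegral_scale//.
rewrite [in RHS]Rintegral_mkcond restrict_supp; last first.
  by move=> y /fv0 ->; rewrite mulr0.
by apply: eq_Rintegral => v _; rewrite K_scale.
Qed.

Let inner t x v := if v <= t then K x v * (f (v / t) - f v) / (1 - t) else 0.

Let measurable_inner t x : measurable_fun [set: R] (inner t x).
Proof.
apply: measurable_fun_ifT => //; first exact: measurable_fun_ler.
apply: measurable_funM => //; apply: measurable_funM; first exact: measurable_K.
exact: measurable_funB.
Qed.

Let dilation_split t x : 0 < t < 1 ->
  (1 - t)^-1 * \int[mu]_(v in `]0, 1]) (K x v * (f (v / t) - f v)) =
  \int[mu]_(v in `]0, 1]) inner t x v -
  (1 - t)^-1 * \int[mu]_(v in `]t, 1]) (K x v * f v).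
Proof.
move=> /andP[t0 t1].
have mh : measurable_fun [set: R] (fun v => K x v * (f (v / t) - f v)).
  by apply: measurable_funM; [exact: measurable_K|exact: measurable_funB].
have hM y : `|K x y * (f (y / t) - f y)| <= M + M.
  rewrite normrM -[leRHS]mul1r; apply: ler_pM => //.
    by apply: (le_trans (K_le _ _)); lra.
  by rewrite (le_trans (ler_normB _ _))// lerD.
have ih a b : mu.-integrable `]a, b] (EFin \o (fun v => K x v * (f (v / t) - f v))).
  exact: integrable_itv_bounded.
have t1' : 0 < 1 - t by rewrite subr_gt0.
have minn := measurable_inner t x.
have iinn : mu.-integrable `]0, 1] (EFin \o inner t x).
  apply: (@integrable_itv_bounded _ _ _ _ ((M + M) / (1 - t))) => // y _.
  rewrite /inner; case: ifPn => _; last by rewrite normr0 mulr_ge0 ?invr_ge0 ?(ltW t1')// addr_ge0.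
  rewrite normrM (ger0_norm (x := _^-1)) ?invr_ge0 ?(ltW t1')//.
  by rewrite ler_pM2r ?invr_gt0.
rewrite (Rintegral_itv_split (ltW t0) (ltW t1))//.
rewrite (Rintegral_itv_split (f := inner t x) (ltW t0) (ltW t1))//.
have -> : \int[mu]_(v in `]t, 1]) inner t x v = 0.
  transitivity (\int[mu]_(v in `]t, 1]) (0 : R)).
    apply: eq_Rintegral => v; rewrite inE/= in_itv/= => /andP[tv _].
    by rewrite /inner leNgt tv.
  by rewrite Rintegral_itv_cst ?(ltW t1)// mul0r.
have -> : \int[mu]_(v in `]0, t]) inner t x v =
    (1 - t)^-1 * \int[mu]_(v in `]0, t]) (K x v * (f (v / t) - f v)).
  rewrite -RintegralZl//; apply: eq_Rintegral => v; rewrite inE/= in_itv/= => /andP[_ vt].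
  by rewrite /inner vt mulrC.
(* For [v > t] the point [v / t] lies beyond 1, where [f] is 0: this is the source of the boundary
   term. *)
have -> : \int[mu]_(v in `]t, 1]) (K x v * (f (v / t) - f v)) =
    - \int[mu]_(v in `]t, 1]) (K x v * f v).
  rewrite -[RHS]mulN1r -RintegralZl//; last exact: integrable_itv_bounded.
  apply: eq_Rintegral => v; rewrite inE/= in_itv/= => /andP[tv _].
  rewrite (f0 (y := v / t)) ?sub0r ?mulN1r ?mulrN//.
  by rewrite negb_and -!ltNge; apply/orP; right; rewrite ltr_pdivlMr// mul1r.
by rewrite addr0 mulrDr mulrN.
Qed.

(** The increment of [f] over [[v, v / t]] is at most [A v^(1/4 - 1) (1 - t) / t]. Here [1/t <= 2]
    because [tseq] starts at 1/2, and [|K| <= 1/2] absorbs the 2. *)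
Let inner_le n x v : 0 < v <= 1 ->
  `|inner (tseq n) x v| <= A * v `^ (4^-1 - 1).
Proof.
move=> /andP[v0 v1]; have /andP[t2 t1] := @tseq_itv R n.
set t := tseq n in t1 t2 *.
have t0 : 0 < t by lra.
have t1' : 0 < 1 - t by rewrite subr_gt0.
have p0 : 0 <= A * v `^ (4^-1 - 1) by rewrite mulr_ge0// powR_ge0.
rewrite /inner; case: ifPn => [vt|_]; last by rewrite normr0.
rewrite normrM (ger0_norm (x := _^-1)) ?invr_ge0 ?(ltW t1')// ler_pdivrMr// normrM.
have I := increment_le mS A0 SA fS v0 (w := v / t).
have vvt : v <= v / t by rewrite ler_pdivlMr// ger_pMr// ltW.
have vt1 : v / t <= 1 by rewrite ler_pdivrMr// mul1r.
have {I vvt vt1} I := I vvt vt1.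
have -> : A * v `^ (4^-1 - 1) * (1 - t) =
    2^-1 * (2 * (A * (v `^ 4^-1 / v) * (1 - t))).
  by rewrite powR4_div//; field; rewrite gt_eqF.
apply: ler_pM => //; first exact: K_le.
apply: (le_trans I).
have -> : A * (v `^ 4^-1 / (v * v)) * (v / t - v) = t^-1 * (A * (v `^ 4^-1 / v) * (1 - t)).
  by field; rewrite !gt_eqF.
apply: ler_wpM2r; first by rewrite !mulr_ge0 ?powR_ge0 ?invr_ge0 ?(ltW v0) ?(ltW t1').
by rewrite invf_ple ?posrE//; lra.
Qed.

Let inner_cvg (x v : R) : 0 < v < 1 -> is_derive v 1 f (S v) ->
  inner (tseq n) x v @[n --> \oo] --> K x v * (v * S v).
Proof.
move=> /andP[v0 v1] [dv dS].
have H : h^-1 * (f (h + v) - f v) @[h --> 0^'] --> S v.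
  have : h^-1 *: (f (h *: 1 + v) - f v) @[h --> 0^'] --> S v.
    by rewrite -dS; exact: dv.
  have -> : (fun h : R => h^-1 *: (f (h *: 1 + v) - f v)) =
      (fun h : R => h^-1 * (f (h + v) - f v)).
    by apply/funext => h; rewrite /GRing.scale/= mulr1.
  exact.
(* With this step, [(f(v/t) - f(v)) / (1 - t)] is [v / t] times the difference quotient of [f] at
   [v]. *)
pose h n := v / tseq n - v.
have t0 n : 0 < tseq n :> R by have /andP[] := @tseq_itv R n; lra.
have hc : h n @[n --> \oo] --> (0 : R).
  rewrite (_ : 0 = v / 1 - v); last by rewrite divr1 subrr.
  apply: cvgB; last exact: cvg_cst.
  apply: cvgM; first exact: cvg_cst.
  by apply: cvgV; [rewrite oner_eq0|exact: tseq_cvg].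
have h0 n : h n != 0.
  rewrite gt_eqF// /h subr_gt0 ltr_pdivlMr// gtr_pMr//.
  by have /andP[] := @tseq_itv R n.
have Q : (h n)^-1 * (f (h n + v) - f v) @[n --> \oo] --> S v.
  move=> B /H HB; have [N _ HN] := hc _ HB.
  by exists N => // n /= Nn; apply: (HN n Nn); exact: h0.
have Q2 : K x v * (v / tseq n * ((h n)^-1 * (f (h n + v) - f v))) @[n --> \oo]
    --> K x v * (v * S v).
  apply: cvgM; first exact: cvg_cst.
  apply: cvgM => //.
  rewrite -[X in _ --> X]divr1; apply: cvgM; first exact: cvg_cst.
  by apply: cvgV; [rewrite oner_eq0|exact: tseq_cvg].
apply: cvg_trans Q2; apply: near_eq_cvg.
have : \forall n \near \oo, v < tseq n.
  by apply: (cvgr_gt _ tseq_cvg).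
apply: filterS => n vt; rewrite /inner (ltW vt) /h subrK.
have tn1 : 1 - tseq n != 0 :> R.
  have /andP[_ t1] := @tseq_itv R n.
  by rewrite gt_eqF// subr_gt0.
field; rewrite tn1 (gt_eqF (t0 n))/=.
rewrite (_ : v + - v * tseq n = v * (1 - tseq n)); last by ring.
by rewrite mulf_neq0// gt_eqF.
Qed.

Let inner_int_cvg x :
  \int[mu]_(v in `]0, 1]) inner (tseq n) x v @[n --> \oo] -->
  \int[mu]_(v in `]0, 1]) (K x v * (v * S v)).
Proof.
have iG : mu.-integrable `]0, 1] (EFin \o (fun v : R => A * v `^ (4^-1 - 1))).
  have p4 : (0 : R) < 4^-1 by rewrite invr_gt0.
  exact: (integrableZl _ _ (integrable_powR01 p4)).
(* Differentiability is available for [v < 1] only, so the endpoint joins the exceptional null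
   set. *)
have ne1 : {ae mu, forall v : R, v != 1}.
  exists [set 1]; split; [exact: measurable_set1|exact: lebesgue_measure_set1|].
  by move=> v /= /negP; rewrite negbK => /eqP.
have := @dominated_convergence _ _ _ mu `]0, 1] _ (fun n => EFin \o inner (tseq n) x)
  (EFin \o (fun v => K x v * (v * S v))) (EFin \o (fun v : R => A * v `^ (4^-1 - 1))).
move=> /(_ _ _ _ _ iG _)[].
- by [].
- move=> n; apply/measurable_EFinP/measurable_funTS; exact: measurable_inner.
- apply/measurable_EFinP/measurable_funTS; apply: measurable_funM; first exact: measurable_K.
  exact: measurable_funM.
- have [N1 [mN1 N10 sN1]] := deriv_ae mS A0 SA fS.
  have [N2 [mN2 N20 sN2]] := ne1.
  exists (N1 `|` N2); split; first exact: measurableU.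
    by apply/eqP; rewrite measureU0//; exact/eqP.
  move=> v /= Hv; apply: contrapT => /not_orP[h1 h2]; apply: Hv.
  rewrite in_itv/= => /andP[v0 v1].
  have v1' : v < 1.
    by rewrite lt_neqAle v1 andbT; apply: contrapT => h; apply: h2; apply: sN2.
  have dv : is_derive v 1 f (S v).
    apply: contrapT => h; apply: h1; apply: sN1 => /= hh; apply: h; apply: hh.
    by rewrite v0.
  apply: cvg_EFin; first exact: nearW.
  by apply: inner_cvg => //; rewrite v0.
- apply: aeW => v n; rewrite /= in_itv/= => v01; rewrite lee_fin.
  exact: inner_le.
move=> iK _ H; apply: fine_cvg; rewrite fineK; first exact: H.
exact: (integrable_fin_num _ iK).
Qed.

Let boundary_cvg x : 0 < x <= 1 ->
  (1 - tseq n)^-1 * \int[mu]_(v in `]tseq n, 1]) (K x v * f v) @[n --> \oo] -->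
  K x 1 * f 1.
Proof.
move=> /andP[x0 x1].
pose fl : R := (Num.floor x^-1)%:~R.
have /andP[fl1 fl2] := floor_itv x^-1; rewrite intrD -/fl in fl1 fl2.
have xi : 0 < x^-1 by rewrite invr_gt0.
have fl0 : 0 < fl + 1 by exact: lt_trans fl2.
(* For [v0 < v <= 1] the floor of [1/(x v)] keeps its value [fl] at [v = 1]. *)
pose v0 := x^-1 / (fl + 1).
have v00 : 0 < v0 by rewrite divr_gt0.
have v01 : v0 < 1 by rewrite ltr_pdivrMr// mul1r.
(* Freezing the floor and truncating the argument of [f] gives a function that is two-sided
   continuous at 1 and equals [K x v * f v] on []v0, 1]]. Its averages over []t, 1]] tend to
   [g 1]. *)
pose g (v : R) := (2^-1 - x^-1 / v + fl) * f (Num.min v 1).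
have gE v : v0 < v <= 1 -> K x v * f v = g v.
  move=> /andP[v0v v1]; have vp := lt_trans v00 v0v.
  rewrite /g (min_idPl v1) KE// invfM; congr ((_ + _) * _).
  rewrite (@floor_def _ _ (Num.floor x^-1))// intrD -/fl.
  rewrite ler_pdivlMr// ltr_pdivrMr//; apply/andP; split.
    apply: le_trans fl1; apply: ler_piMr => //.
    by rewrite ler0z floor_ge0 ltW.
  by move: v0v; rewrite /v0 ltr_pdivrMr// mulrC.
have cg : {for 1, continuous g}.
  apply: cvgM; last by apply: (holder_inv_continuous fC).
  apply: cvgD; last exact: cvg_cst.
  apply: cvgB; first exact: cvg_cst.
  apply: cvgM; first exact: cvg_cst.
  by apply: cvgV; rewrite ?oner_eq0.
have E1 : K x 1 * f 1 = g 1 by apply: gE; rewrite v01 lexx.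
rewrite E1; apply/cvgrPdist_le => e e0.
have /cvgrPdist_le /(_ _ e0) := cg.
move=> /nbhs_ballP[d /= d0 Hd].
near=> n.
have tv : v0 < tseq n by near: n; apply: (cvgr_gt _ (@tseq_cvg R)).
have td : 1 - d < tseq n.
  by near: n; apply: (cvgr_gt _ (@tseq_cvg R)); rewrite gtrBl.
have /andP[t2 t1] := @tseq_itv R n.
set t := tseq n in tv td t2 t1 *.
have t1' : 0 < 1 - t by rewrite subr_gt0.
have ik : mu.-integrable `]t, 1] (EFin \o (fun v => K x v * f v)).
  exact: integrable_itv_bounded.
have -> : g 1 - (1 - t)^-1 * \int[mu]_(v in `]t, 1]) (K x v * f v) =
    (1 - t)^-1 * \int[mu]_(v in `]t, 1]) (g 1 - K x v * f v).
  rewrite RintegralB//; last exact: integrable_itv_cst.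
  rewrite Rintegral_itv_cst ?(ltW t1)//.
  by move: (Rintegral _ _ _) => I; field; rewrite gt_eqF.
rewrite normrM (ger0_norm (x := _^-1)) ?invr_ge0 ?(ltW t1')// ler_pdivrMl//.
rewrite mulrC; apply: Rintegral_itv_bound; first exact: ltW.
  exact: measurable_funB.
move=> v /andP[tv' v1]; rewrite gE ?v1 ?(lt_trans tv)//.
apply: Hd; rewrite /ball/= ger0_norm ?subr_ge0//.
by move: td tv'; lra.
Unshelve. all: by end_near. Qed.

Lemma derivative_identity x d : 0 < x <= 1 ->
  (f (tseq n * x) - f x) / (tseq n * x - x) @[n --> \oo] --> d ->
  x * d + f x - lam * f 1 * K x 1 = - lam * \int[mu]_(v in `]0, 1]) (K x v * (v * S v)).
Proof.
move=> x01 Hd; have /andP[x0 x1] := x01.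
have t01 n : 0 < (tseq n : R) < 1.
  by have /andP[t2 t1] := @tseq_itv R n; apply/andP; split; lra.
(* The left side is [(t f(t x) - f(x)) / (1 - t)], rewritten with [t x - x = - (1 - t) x] to exhibit
   the difference quotient at [x]. *)
have E n : tseq n * (- x * ((f (tseq n * x) - f x) / (tseq n * x - x))) - f x =
  lam * (\int[mu]_(v in `]0, 1]) inner (tseq n) x v -
    (1 - tseq n)^-1 * \int[mu]_(v in `]tseq n, 1]) (K x v * f v)).
  rewrite -dilation_split// [RHS]mulrCA -dilation//.
  have /andP[t0 t1] := t01 n; move: (tseq n) t0 t1 => t t0 t1.
  field; rewrite subr_eq0 (gt_eqF t1)/=.
  rewrite (_ : t * x - x = (t - 1) * x); last by ring.
  by rewrite mulf_neq0 ?subr_eq0 ?(lt_eqF t1)// gt_eqF.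
have L : tseq n * (- x * ((f (tseq n * x) - f x) / (tseq n * x - x))) - f x
    @[n --> \oo] --> 1 * (- x * d) - f x.
  apply: cvgB; last exact: cvg_cst.
  apply: cvgM; first exact: tseq_cvg.
  by apply: cvgM; first exact: cvg_cst.
have L2 : lam * (\int[mu]_(v in `]0, 1]) inner (tseq n) x v -
    (1 - tseq n)^-1 * \int[mu]_(v in `]tseq n, 1]) (K x v * f v)) @[n --> \oo] -->
    lam * (\int[mu]_(v in `]0, 1]) (K x v * (v * S v)) - K x 1 * f 1).
  apply: cvgM; first exact: cvg_cst.
  by apply: cvgB; [exact: inner_int_cvg|exact: (boundary_cvg x01)].
have : 1 * (- x * d) - f x = lam * (\int[mu]_(v in `]0, 1]) (K x v * (v * S v)) - K x 1 * f 1).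
  rewrite -(cvg_lim _ L)// -(cvg_lim _ L2)//.
  by rewrite (funext E).
by move: (Rintegral _ _ _) => I h; lra.
Qed.

End dilation_identity.

(** * Return to one-sided derivatives on [[0,1]] and to the completed measure *)

Section completed_measure.
Context {R : realType}.
Notation mu := (@lebesgue_measure R).

Lemma is_derive_has_deriv01 (phi : R -> R) (v s : R) : 0 < v < 1 ->
  is_derive v 1 (phi \_ `]0, 1]) s -> has_deriv01 phi v s.
Proof.
move=> /andP[v0 v1] [dv dS] B HB.
have H : h^-1 *: ((phi \_ `]0, 1]) (h *: 1 + v) - (phi \_ `]0, 1]) v) @[h --> 0^'] --> s.
  by rewrite -dS; exact: dv.
have : \forall h \near (0 : R), h != 0 ->
    B (h^-1 *: ((phi \_ `]0, 1]) (h *: 1 + v) - (phi \_ `]0, 1]) v)) := H _ HB.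
move=> {}H.
have f1 (y : R) : 0 < y -> y <= 1 -> (phi \_ `]0, 1]) y = phi y.
  by move=> y0 y1; rewrite patchE mem_set//= in_itv/= y0.
move: H.
apply: filterS2 (_ : \forall h \near (0 : R), 0 < v + h < 1).
  move=> h' /andP[a b] Hh [hn0 _] /=.
  have := Hh hn0; rewrite /GRing.scale/= mulr1 (addrC h' v).
  by rewrite (f1 _ a (ltW b)) (f1 _ v0 (ltW v1)) mulrC.
near=> h'; apply/andP; split.
  rewrite -ltrBlDl sub0r; near: h'; apply: lt_nbhsr; by rewrite oppr_lt0.
by rewrite -ltrBrDl; near: h'; apply: lt_nbhsl; rewrite subr_gt0.
Unshelve. all: by end_near. Qed.

(** Completeness makes [h] measurable as soon as it agrees almost everywhere with a Borel function.
    This handles [Qf] without studying the set where the derivative exists. *)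
Lemma int01_ae_eq (g h : R -> R) : measurable_fun [set: R] g ->
  {ae mu, forall y : R, 0 < y < 1 -> h y = g y} ->
  int01 h = \int[mu]_(y in `]0, 1]) g y.
Proof.
move=> mg [N [mN N0 sN]]; rewrite -int01_borel//.
have mI := @measurable_I01 R.
have mg' : measurable_fun (@I01 R) (EFin \o g : LR R -> \bar R).
  by apply/measurable_EFinP; exact: borel_lebesgue_fun.
have aeq : ae_eq (@completed_lebesgue_measure R) (@I01 R) (EFin \o g) (EFin \o h).
  (* The two endpoints, about which the hypothesis is silent, are added to the null set. *)
  exists (N `|` [set 0; 1]); split.
  - apply: borel_lebesgue; apply: measurableU => //.
    by apply: measurableU; exact: measurable_set1.
  - transitivity (mu (N `|` [set 0; 1])); first by [].
    have m01 : measurable ([set 0; 1] : set R) by apply: measurableU; exact: measurable_set1.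
    by rewrite null_set_setU// null_set_setU//; exact: lebesgue_measure_set1.
  move=> y /= Hy; apply: contrapT => /not_orP[h1 /not_orP[h2 h3]]; apply: Hy.
  rewrite /I01/= in_itv/= => /andP[y0 y1]; congr EFin; apply/esym.
  apply: contrapT => hh; apply: h1; apply: sN => /= hy; apply: hh; apply: hy.
  rewrite !lt_neqAle y0 y1 !andbT; apply/andP; split; apply/eqP => //.
  by move=> e; apply: h2.
have mh := ae_measurable_fun (@completed_lebesgue_measure_is_complete R) aeq mg'.
exact: (congr1 fine (esym (ae_eq_integral _ _ mI mg' mh aeq))).
Qed.

End completed_measure.

(** * The identity for [phi], from that for its restriction to []0, 1]] *)

Theorem theorem4p13 (R : realType) (phi : R -> R) (lam : R) :
  lam != 0 -> is_eigenfunction phi lam ->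
  (\int[@leb R]_(y in (@I01 R)) ((phi y) ^+ 2)%:E = 1)%E ->
  forall x : R, 0 < x <= 1 -> deriv01_exists phi x ->
  x * deriv01 phi x + phi x - lam * phi 1 * K x 1 = Pf phi lam x.
Proof.
move=> _ ephi nphi x x01 [d Hd].
rewrite (deriv01E x01 Hd).
pose f : R -> R := phi \_ `]0, 1].
have f1 (y : R) : 0 < y <= 1 -> f y = phi y.
  by move=> y01; rewrite /f patchE mem_set//= in_itv.
have f0 (y : R) : ~~ (0 < y <= 1) -> f y = 0.
  by move=> /negP y01; rewrite /f patchE memNset//= in_itv.
have mf : measurable_fun [set: R] f := eigenfunction_measurable ephi nphi.
have fM (y : R) : `|f y| <= `|lam|.
  have [y01|/f0 ->] := boolP (0 < y <= 1); last by rewrite normr0.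
  rewrite f1// (eigenfunction_bound ephi nphi)//.
  by move: y01 => /andP[/ltW -> ->].
have fC x1 x2 : 0 < x1 <= 1 -> 0 < x2 <= 1 ->
    `|f x1 - f x2| <= 5 * lam ^+ 2 * Num.sqrt `|x1^-1 - x2^-1|.
  by move=> h1 h2; rewrite !f1//; exact: eigenfunction_holder.
have fE := eigenfunctionE ephi nphi; rewrite -/f in fE.
have fD := decay mf fM fC fE.
have D0 := decay_cst_ge0 lam fM fC.
have mS := measurable_density lam mf f0 D0 fD.
have fS := density_repr mf f0 fM fC D0 fD fE.
have SA := density_bound lam mf f0 fM fC D0 fD.
have A0 := density_cst_ge0 lam fM fC D0.
have Hseq : (f (tseq n * x) - f x) / (tseq n * x - x) @[n --> \oo] --> d.
  have := has_deriv01_seq x01 Hd.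
  have -> // : (fun n => (phi (tseq n * x) - phi x) / (tseq n * x - x)) =
    (fun n => (f (tseq n * x) - f x) / (tseq n * x - x)).
  apply/funext => n; rewrite !f1//; have /andP[x0 x1] := x01.
  have /andP[t2 t1] := @tseq_itv R n.
  rewrite mulr_gt0//=; last by lra.
  by rewrite (le_trans _ x1)// ger_pMl// ltW.
have := derivative_identity mf f0 fM fC fE mS A0 SA fS x01 Hseq.
rewrite !f1// ?ltr01 ?lexx// => ->.
rewrite /Pf; congr (_ * _); apply/esym; apply: int01_ae_eq.
  apply: measurable_funM; first exact: measurable_K.
  exact: measurable_funM.
(* For almost every [y] the derivative exists and equals the density there, so [Qf phi y] is [y]
   times the density. *)
have := deriv_ae mS A0 SA fS.
apply: filterS; first exact: (ae_filter_ringOfSetsType lebesgue_measure).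
move=> y H y01; congr (_ * _).
have Hy := is_derive_has_deriv01 y01 (H y01).
rewrite /Qf; case: asboolP => [_|[]]; last by eexists; exact: Hy.
rewrite (deriv01E _ Hy)//.
by move: y01 => /andP[-> /ltW].
Qed.
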